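(* Let $T$ be a commuting contractive $n$-tuple of bounded operators on a complex Hilbert space $\mathcal{H}$, let $a \in \mathbb{B}_n$, let $u$ be a unitary operator on $\mathbb{C}^n$, and let $u \circ \varphi_a$ be the corresponding (arbitrary) biholomorphic automorphism of $\mathbb{B}_n$. Then the operator valued contractive analytic functions $$\{ \mathcal{D}_{T}, \mathcal{D}_{T^*}, \theta_T \circ \varphi_a \circ u^* \} \quad \text{and} \quad \{ \mathcal{D}_{u(T_a)}, \mathcal{D}_{u(T_a)^*}, \theta_{u(T_a)} \}$$ coincide weakly.
   Context: $\mathbb{B}_n$ is the open Euclidean unit ball of $\mathbb{C}^n$. A commuting contractive $n$-tuple $T=(T_1,\dots,T_n)$ on $\mathcal{H}$ is a tuple of commuting bounded operators with $\sum_{i=1}^n T_iT_i^*\le 1_{\mathcal{H}}$. The letter $T$ also denotes the row contraction $\mathcal{H}^n\to\mathcal{H}$, $(h_1,\dots,h_n)\mapsto \sum_i T_ih_i$, with adjoint $T^*:\mathcal{H}\to\mathcal{H}^n$, $h\mapsto (T_1^*h,\dots,T_n^*h)$. Put $D_{T^*}=(1_{\mathcal{H}}-TT^* )^{1/2}$, $\mathcal{D}_{T^*}=\overline{\mathrm{Ran}}\,D_{T^*}\subset\mathcal{H}$, $D_T=(1_{\mathcal{H}^n}-T^*T)^{1/2}$, $\mathcal{D}_T=\overline{\mathrm{Ran}}\,D_T\subset\mathcal{H}^n$. Characteristic function of $T$: the operator valued contractive analytic function $\{\mathcal{D}_T,\mathcal{D}_{T^*},\theta_T\}$ with $\theta_T(z)=-T+D_{T^*}(1_{\mathcal{H}}-ZT^*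 )^{-1}ZD_T$ restricted to $\mathcal{D}_T$, $z\in\mathbb{B}_n$, where $Z=(z_1I_{\mathcal{H}},\dots,z_nI_{\mathcal{H}}):\mathcal{H}^n\to\mathcal{H}$ is the row operator induced by $z$. For $a\in\mathbb{B}_n$, $a\neq 0$, let $P_a$ be the orthogonal projection of $\mathbb{C}^n$ onto $\mathbb{C}a$, $Q_a=I-P_a$, $s_a=(1-|a|^2)^{1/2}$, and $$\varphi_a(z)=\frac{a-P_az-s_aQ_az}{1-\langle z,a\rangle}.$$ With the row operator $A=(a_1I_{\mathcal{H}},\dots,a_nI_{\mathcal{H}})$, put $P_aT=\frac{1}{|a|^2}TA^*A$, $Q_aT=T-P_aT$ (row operators), and $$T_a=(1-TA^* )^{-1}(A-P_aT-s_aQ_aT).$$ For $a=0$ the convention is $P_0=0$, $Q_0=I$, so $\varphi_0(z)=-z$ and $T_0=-T$. The tuple $T_a$ is again a commuting contractive tuple. For a unitary $u$ on $\mathbb{C}^n$ with matrix $(u_{ij})$, $u(T)$ denotes the commuting contractive tuple $(\sum_j u_{1j}T_j,\dots,\sum_j u_{nj}T_j)$. Every biholomorphic automorphism of $\mathbb{B}_n$ is of the form $u\circ\varphi_a$. An operator valued bounded function on $\mathbb{B}_n$ is a triple $\{\mathcal{E},\mathcal{E}_*,\varphi\}$ with Hilbert spaces $\mathcal{E},\mathcal{E}_*$ and a bounded function $\varphi:\mathbb{B}_n\to\mathcal{B}(\mathcal{E},\mathcal{E}_* )$; it is contractive if $\|\varphi(z)\|\le 1$ for all $z$. Two such functions $\{\mathcal{E},\mathcal{E}_*,\varphi\}$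 and $\{\mathcal{F},\mathcal{F}_*,\psi\}$ coincide weakly if there is a unitary operator $\tau:\mathcal{E}_*\to\mathcal{F}_*$ with $\psi(w)\psi(z)^*=\tau\varphi(w)\varphi(z)^*\tau^*$ for all $z,w\in\mathbb{B}_n$. *)

(* Defs.v *)
From HB Require Import structures.
From mathcomp Require Import all_boot all_order all_algebra.
From mathcomp Require Import spectral sesquilinear complex.
From mathcomp Require Import boolp classical_sets filter reals topology normedtype.

Set Implicit Arguments.
Unset Strict Implicit.
Unset Printing Implicit Defensive.

Import Order.TTheory GRing.Theory Num.Theory.
Import numFieldNormedType.Exports.

Local Open Scope classical_set_scope.
Local Open Scope ring_scope.
Local Open Scope sesquilinear_scope.

(* The inner product is linear in its first argument. *)
HB.mixin Record NormedModule_isInner (C : numClosedFieldType) H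
    & NormedModule C H := {
  inner : {dot H for (@Num.conj C)};
  sqr_norm_inner : forall x : H, `|x| ^+ 2 = inner x x
}.

#[short(type="preHilbertType")]
HB.structure Definition PreHilbert (C : numClosedFieldType) :=
  {H of NormedModule C H & NormedModule_isInner C H}.

#[short(type="hilbertType")]
HB.structure Definition Hilbert (C : numClosedFieldType) :=
  {H of PreHilbert C H & Complete H}.

Reserved Notation "''[' x , y ]" (at level 0, format "''[' x ,  y ]").
Notation "''[' x , y ]" := (inner x%R y%R) : ring_scope.

Lemma CauchySchwarz_subproof (C : numClosedFieldType) (a p q : C) : 0 < q ->
  0 <= a + `|p / q| ^+ 2 * q - ((p / q)^* * p + ((p / q)^* * p)^*) ->
  `|p| ^+ 2 <= a * q.
Proof.
move=> q0; have q_neq0 : q != 0 by rewrite gt_eqF.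
have cq : q^* = q by rewrite geC0_conj// ltW.
have -> : (p / q)^* * p = `|p| ^+ 2 / q.
  by rewrite rmorphM/= fmorphV/= cq mulrAC normCKC.
have -> : (`|p| ^+ 2 / q)^* = `|p| ^+ 2 / q.
  by rewrite geC0_conj// divr_ge0 ?exprn_ge0// ltW.
rewrite normrM normfV (gtr0_norm q0).
have -> : (`|p| / q) ^+ 2 * q = `|p| ^+ 2 / q.
  by rewrite expr2 -mulrA divfK// mulrAC -expr2.
by rewrite opprD addrA addrK subr_ge0 ler_pdivrMr.
Qed.

Section DotNorm.
Variables (C : numClosedFieldType) (U : lmodType C) (f : {dot U for (@Num.conj C)}).

Definition dnorm (x : U) : C := sqrtC (f x x).

Lemma dnorm_CauchySchwarz u v : `|f u v| <= dnorm u * dnorm v.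
Proof.
have [->|v0] := eqVneq v 0.
  by rewrite linear0r normr0 mulr_ge0// sqrtC_ge0 dnorm_ge0.
have fv0 : 0 < f v v by rewrite dnorm_gt0.
rewrite /dnorm -sqrtCM ?nnegrE ?dnorm_ge0//.
rewrite -(ler_pXn2r (n := 2%N)) ?nnegrE ?sqrtC_ge0 ?mulr_ge0 ?dnorm_ge0// sqrtCK.
apply: CauchySchwarz_subproof => //.
have := dnorm_ge0 f (u - (f u v / f v v) *: v).
by rewrite dnormB dnormZ linearZr_LR.
Qed.

Lemma ler_dnormD x y : dnorm (x + y) <= dnorm x + dnorm y.
Proof.
have d0 z : 0 <= dnorm z by rewrite sqrtC_ge0 dnorm_ge0.
rewrite -(ler_pXn2r (n := 2%N)) ?nnegrE ?addr_ge0// sqrtCK dnormD.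
rewrite sqrrD !sqrtCK [leRHS]addrAC lerD2l.
have -> : f x y + (f x y)^* = 'Re (f x y) *+ 2.
  by rewrite ReE -mulr_natr divfK ?pnatr_eq0.
rewrite lerMn2r/= (le_trans _ (dnorm_CauchySchwarz x y))//.
by have [] := leif_Re_Creal (f x y).
Qed.

Lemma dnormZ_norm l x : dnorm (l *: x) = `|l| * dnorm x.
Proof.
by rewrite /dnorm dnormZ sqrtCM ?nnegrE ?exprn_ge0 ?dnorm_ge0// sqrCK.
Qed.

Lemma dnorm_eq0_eq0 x : dnorm x = 0 -> x = 0.
Proof. by move=> /eqP; rewrite sqrt_dnorm_eq0 => /eqP. Qed.

End DotNorm.

HB.factory Record Lmodule_isPreHilbert (C : numClosedFieldType) H
    & GRing.Lmodule C H := {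
  inner : {dot H for (@Num.conj C)}
}.

HB.builders Context C H & Lmodule_isPreHilbert C H.

HB.instance Definition _ := Lmodule_isNormed.Build C H
  (ler_dnormD inner) (dnormZ_norm inner) (@dnorm_eq0_eq0 _ _ inner).

Let sqr_norm_inner (x : H) : `|x| ^+ 2 = inner x x.
Proof. exact: sqrtCK. Qed.

HB.instance Definition _ := NormedModule_isInner.Build C H sqr_norm_inner.

HB.end.

Definition hpow (C : numClosedFieldType) (H : hilbertType C) (n : nat) :=
  {ffun 'I_n -> H}.

Section HilbertPower.
Variables (C : numClosedFieldType) (H : hilbertType C) (n : nat).
Local Notation Hn := (hpow H n).

HB.instance Definition _ := GRing.Lmodule.copy Hn {ffun 'I_n -> H}.

Definition hpow_inner (x y : Hn) : C := \sum_i '[x i, y i].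

Let hpow_inner_linearl (y : Hn) : zmod_morphism (hpow_inner ^~ y).
Proof.
move=> x x'; rewrite /hpow_inner -sumrB; apply: eq_bigr => i _.
by rewrite !ffunE linearBl.
Qed.

Let hpow_inner_linearr (x : Hn) : zmod_morphism (hpow_inner x).
Proof.
move=> y y'; rewrite /hpow_inner -sumrB; apply: eq_bigr => i _.
by rewrite !ffunE linearBr.
Qed.

Let hpow_inner_scalel (y : Hn) : scalable_for *%R (hpow_inner ^~ y).
Proof.
move=> a x; rewrite /hpow_inner /= mulr_sumr; apply: eq_bigr => i _.
by rewrite !ffunE linearZl_LR.
Qed.

Let hpow_inner_scaler (x : Hn) :
  scalable_for ((@Num.conj C) \; *%R) (hpow_inner x).
Proof.
move=> a y; rewrite /hpow_inner /= mulr_sumr; apply: eq_bigr => i _.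
by rewrite !ffunE linearZr_LR.
Qed.

HB.instance Definition _ := @isBilinear.Build C Hn Hn C *%R
  ((@Num.conj C) \; *%R) hpow_inner hpow_inner_linearl hpow_inner_linearr
  hpow_inner_scalel hpow_inner_scaler.

Let hpow_inner_herm (x y : Hn) :
  hpow_inner x y = (-1) ^+ false * (hpow_inner y x)^*.
Proof.
rewrite expr0 mul1r rmorph_sum/=; apply: eq_bigr => i _.
by rewrite hermC/= expr0 mul1r.
Qed.

HB.instance Definition _ := @isHermitianSesquilinear.Build C Hn false
  (@Num.conj C) hpow_inner hpow_inner_herm.

Let hpow_inner_gt0 (x : Hn) : x != 0 -> 0 < hpow_inner x x.
Proof.
move=> x0; have [i xi0] : exists i, x i != 0.
  apply: contrapT => /forallNP xi; move/eqP: x0; apply.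
  by apply/ffunP => i; rewrite ffunE; apply/eqP/negPn/negP/xi.
rewrite /hpow_inner (bigD1 i)//= ltr_pwDl ?dnorm_gt0// sumr_ge0//.
Qed.

HB.instance Definition _ := @isDotProduct.Build C Hn hpow_inner hpow_inner_gt0.

HB.instance Definition _ := Lmodule_isPreHilbert.Build C Hn hpow_inner.

Lemma hpow_norm (x : Hn) : `|x| ^+ 2 = \sum_i `|x i| ^+ 2.
Proof.
rewrite sqr_norm_inner; apply: eq_bigr => i _.
by rewrite sqr_norm_inner.
Qed.

Lemma ler_norm_coord (x : Hn) i : `|x i| <= `|x|.
Proof.
rewrite -(ler_pXn2r (n := 2%N)) ?nnegrE ?normr_ge0// hpow_norm.
by rewrite (bigD1 i)//= lerDl sumr_ge0// => j _; rewrite exprn_ge0.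
Qed.

Lemma ler_norm_sum (x : Hn) : `|x| <= \sum_i `|x i|.
Proof.
rewrite -(ler_pXn2r (n := 2%N)) ?nnegrE ?normr_ge0 ?sumr_ge0//.
rewrite hpow_norm expr2 mulr_suml; apply: ler_sum => i _.
by rewrite expr2 ler_wpM2l// (bigD1 i)//= lerDl sumr_ge0//.
Qed.

Let hpow_complete (F : set_system Hn) : ProperFilter F -> cauchy F -> cvg F.
Proof.
move=> FF /cauchy_ballP cF.
have cvi (i : 'I_n) : cvg ((fun x : Hn => x i) @ F).
  apply: cauchy_cvg; apply/cauchy_ballP => e e0.
  near_simpl; apply: filterS (cF e e0) => -[x y] /=.
  rewrite -!ball_normE /ball_/= => xye.
  by apply: le_lt_trans xye; rewrite (le_trans _ (ler_norm_coord _ i))// !ffunE.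
pose l : Hn := [ffun i => lim ((fun x : Hn => x i) @ F)].
apply/cvg_ex; exists l; apply/cvgrPdist_lt => e e0.
have en : 0 < e / n.+1%:R by rewrite divr_gt0// ltr0Sn.
have : F [set x : Hn | forall i : 'I_n, `|l i - x i| < e / n.+1%:R].
  apply: filter_forall => i; rewrite /l ffunE.
  by move/cvgrPdist_lt: (cvi i); apply.
apply: filterS => x lx; apply: le_lt_trans (ler_norm_sum _) _.
apply: (@le_lt_trans _ _ (\sum_(i < n) e / n.+1%:R)).
  by apply: ler_sum => i _; have := ltW (lx i); rewrite !ffunE.
rewrite sumr_const card_ord -[ltLHS]mulr_natr mulrAC ltr_pdivrMr ?ltr0Sn//.
by rewrite ltr_pM2l// ltr_nat.
Unshelve. all: by end_near. Qed.

HB.instance Definition _ := Uniform_isComplete.Build Hn hpow_complete.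

End HilbertPower.

Record closed_subspace (C : numClosedFieldType) (H : hilbertType C) :=
  ClosedSubspace {
    csubset :> set H;
    csubset_submod : submod_closed (mem csubset);
    csubset_closed : closed csubset
  }.

Arguments csubset_closed {C H} _.

Definition csubset_pred (C : numClosedFieldType) (H : hilbertType C)
  (V : closed_subspace H) : {pred H} := fun x => x \in csubset V.

Definition subspace_type (C : numClosedFieldType) (H : hilbertType C)
  (V : closed_subspace H) := {x : H | x \in csubset_pred V}.

Section SubspaceHilbert.
Variables (C : numClosedFieldType) (H : hilbertType C) (V : closed_subspace H).
Local Notation K := (subspace_type V).

HB.instance Definition _ := [isSub of K for sval].
HB.instance Definition _ := [Choice of K by <:].
HB.instance Definition _ := @GRing.isSubmodClosed.Build C H (csubset_pred V)
  (csubset_submod V).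
HB.instance Definition _ := [SubChoice_isSubLmodule of K by <:].

Definition subspace_inner (x y : K) : C := '[val x, val y].

Let subspace_inner_linearl (y : K) : zmod_morphism (subspace_inner ^~ y).
Proof. by move=> x x'; rewrite /subspace_inner raddfB linearBl. Qed.

Let subspace_inner_linearr (x : K) : zmod_morphism (subspace_inner x).
Proof. by move=> y y'; rewrite /subspace_inner raddfB. Qed.

Let subspace_inner_scalel (y : K) : scalable_for *%R (subspace_inner ^~ y).
Proof. by move=> a x; rewrite /subspace_inner linearZ/= linearZl_LR. Qed.

Let subspace_inner_scaler (x : K) :
  scalable_for ((@Num.conj C) \; *%R) (subspace_inner x).
Proof. by move=> a y; rewrite /subspace_inner linearZ. Qed.

HB.instance Definition _ := @isBilinear.Build C K K C *%R
  ((@Num.conj C) \; *%R) subspace_inner subspace_inner_linearl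
  subspace_inner_linearr subspace_inner_scalel subspace_inner_scaler.

Let subspace_inner_herm (x y : K) :
  subspace_inner x y = (-1) ^+ false * (subspace_inner y x)^*.
Proof. by rewrite /subspace_inner hermC. Qed.

HB.instance Definition _ := @isHermitianSesquilinear.Build C K false
  (@Num.conj C) subspace_inner subspace_inner_herm.

Let subspace_inner_gt0 (x : K) : x != 0 -> 0 < subspace_inner x x.
Proof.
move=> x0; rewrite /subspace_inner dnorm_gt0.
by apply: contra x0 => /eqP x0; apply/eqP/val_inj; rewrite raddf0.
Qed.

HB.instance Definition _ := @isDotProduct.Build C K subspace_inner
  subspace_inner_gt0.

HB.instance Definition _ := Lmodule_isPreHilbert.Build C K subspace_inner.

Lemma subspace_norm (x : K) : `|x| = `|val x|.
Proof.
by apply/eqP; rewrite -(@eqrXn2 _ 2%N)// !sqr_norm_inner.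
Qed.

Let subspace_complete (F : set_system K) : ProperFilter F -> cauchy F -> cvg F.
Proof.
move=> FF /cauchy_ballP cF.
have /cvg_ex[l Fl] : cvg ((val : K -> H) @ F).
  apply: cauchy_cvg; apply/cauchy_ballP => e e0.
  near_simpl; apply: filterS (cF e e0) => -[x y] /=.
  by rewrite -!ball_normE /ball_/= subspace_norm raddfB.
have Vl : csubset V l.
  have FV : \forall x \near F, csubset V (val x).
    by apply: filterE => x; have := valP x; rewrite inE.
  exact: (@closed_cvg K H F FF val (csubset V) (csubset_closed V) FV l Fl).
apply/cvg_ex; exists (Sub l (mem_set Vl)); apply/cvgrPdist_le => e e0.
move/cvgrPdist_le : Fl => /(_ _ e0); apply: filterS => x /=.
by rewrite subspace_norm raddfB.
Qed.

HB.instance Definition _ := Uniform_isComplete.Build K subspace_complete.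

End SubspaceHilbert.

Record bop (C : numClosedFieldType) (E F : hilbertType C) := Bop {
  bop_fun :> E -> F;
  bop_linear : linear bop_fun;
  bop_bounded : exists M : C, forall x, `|bop_fun x| <= M * `|x|
}.

HB.instance Definition _ (C : numClosedFieldType) (E F : hilbertType C)
  (A : bop E F) := GRing.isLinear.Build C E F *:%R A (@bop_linear C E F A).

Section BopModule.
Variables (C : numClosedFieldType) (E F : hilbertType C).
Implicit Types A B : bop E F.

Lemma bopP A B : (forall x, A x = B x) -> A = B.
Proof.
case: A B => [A lA bA] [B lB bB] /= /funext AB; subst B.
by congr Bop; exact: Prop_irrelevance.
Qed.

HB.instance Definition _ := gen_eqMixin (bop E F).
HB.instance Definition _ := gen_choiceMixin (bop E F).

Lemma bop_zero_bounded : exists M : C, forall x : E, `|(\0 : E -> F) x| <= M * `|x|.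
Proof. by exists 0 => x; rewrite normr0 mul0r. Qed.

Lemma bop_add_bounded A B :
  exists M : C, forall x : E, `|(A \+ B) x| <= M * `|x|.
Proof.
have [[M AM] [N BN]] := (bop_bounded A, bop_bounded B).
exists (M + N) => x; rewrite mulrDl.
by apply: le_trans (ler_normD _ _) _; exact: lerD.
Qed.

Lemma bop_scale_bounded a A :
  exists M : C, forall x : E, `|(a \*: A) x| <= M * `|x|.
Proof.
have [M AM] := bop_bounded A.
by exists (`|a| * M) => x; rewrite normrZ -mulrA ler_wpM2l.
Qed.

Lemma bop_opp_bounded A : exists M : C, forall x : E, `|(\- A) x| <= M * `|x|.
Proof. by have [M AM] := bop_bounded A; exists M => x; rewrite normrN. Qed.

Definition bop_zero : bop E F := @Bop C E F \0 (linearP _) bop_zero_bounded.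
Definition bop_add A B : bop E F := @Bop C E F (A \+ B) (linearP _) (bop_add_bounded A B).
Definition bop_opp A : bop E F := @Bop C E F (\- A) (linearP _) (bop_opp_bounded A).
Definition bop_scale a A : bop E F := @Bop C E F (a \*: A) (linearP _) (bop_scale_bounded a A).

Let bop_addA : associative bop_add.
Proof. by move=> A B D; apply: bopP => x /=; exact: addrA. Qed.
Let bop_addC : commutative bop_add.
Proof. by move=> A B; apply: bopP => x /=; exact: addrC. Qed.
Let bop_add0 : left_id bop_zero bop_add.
Proof. by move=> A; apply: bopP => x /=; exact: add0r. Qed.
Let bop_addN : left_inverse bop_zero bop_opp bop_add.
Proof. by move=> A; apply: bopP => x /=; exact: addNr. Qed.

HB.instance Definition _ := GRing.isZmodule.Build (bop E F)
  bop_addA bop_addC bop_add0 bop_addN.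

Let bop_scaleA a b A : bop_scale a (bop_scale b A) = bop_scale (a * b) A.
Proof. by apply: bopP => x /=; exact: scalerA. Qed.
Let bop_scale1 : left_id 1 bop_scale.
Proof. by move=> A; apply: bopP => x /=; exact: scale1r. Qed.
Let bop_scaleDr : right_distributive bop_scale +%R.
Proof. by move=> a A B; apply: bopP => x /=; exact: scalerDr. Qed.
Let bop_scaleDl A : {morph bop_scale^~ A : a b / a + b}.
Proof. by move=> a b; apply: bopP => x /=; exact: scalerDl. Qed.

HB.instance Definition _ := GRing.Zmodule_isLmodule.Build C (bop E F)
  bop_scaleA bop_scale1 bop_scaleDr bop_scaleDl.

Lemma bopDE A B x : (A + B) x = A x + B x. Proof. by []. Qed.
Lemma bopNE A x : (- A) x = - A x. Proof. by []. Qed.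
Lemma bop0E x : (0 : bop E F) x = 0. Proof. by []. Qed.
Lemma bopZE a A x : (a *: A) x = a *: A x. Proof. by []. Qed.

Lemma bop_sumE I (r : seq I) (P : pred I) (A : I -> bop E F) x :
  (\sum_(i <- r | P i) A i) x = \sum_(i <- r | P i) A i x.
Proof. by elim/big_rec2: _ => // i y B _ <-. Qed.

End BopModule.

Section BopOps.
Variable C : numClosedFieldType.
Implicit Types E F G : hilbertType C.

Lemma bop_id_bounded E : exists M : C, forall x : E, `|idfun x| <= M * `|x|.
Proof. by exists 1 => x; rewrite mul1r. Qed.

Definition bop_id E : bop E E := @Bop C E E idfun (linearP _) (@bop_id_bounded E).

Lemma bop_comp_bounded E F G (A : bop F G) (B : bop E F) :
  exists M : C, forall x : E, `|(A \o B) x| <= M * `|x|.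
Proof.
have [[M AM] [N BN]] := (bop_bounded A, bop_bounded B).
exists (`|M| * N) => x; rewrite -mulrA.
apply: le_trans (AM _) _; apply: (@le_trans _ _ (`|M| * `|B x|)).
  have := AM (B x); have [->|Bx0] := eqVneq (B x) 0; first by rewrite normr0 !mulr0.
  move=> /(le_trans (normr_ge0 _)) MB0.
  have M0 : 0 <= M by rewrite -(pmulr_lge0 _ (_ : 0 < `|B x|)) ?normr_gt0.
  by rewrite ger0_norm.
by rewrite ler_wpM2l.
Qed.

Definition bop_comp E F G (A : bop F G) (B : bop E F) : bop E G :=
  @Bop C E G (A \o B) (linearP _) (bop_comp_bounded A B).

(* Over the scalars R[i], R : realType, the Riesz representation theorem gives *)
(* every bounded operator exactly one bounded adjoint.                         *)
Definition adjoint E F (A : bop E F) : bop F E :=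
  xget 0 [set B : bop F E | forall x y, '[A x, y] = '[x, B y]].

(* The two-sided inverse in B(E), and 0 if A is not invertible. *)
Definition bop_inv E (A : bop E E) : bop E E :=
  xget 0 [set B : bop E E | bop_comp A B = bop_id E /\ bop_comp B A = bop_id E].

(* 0 <= z in C entails that z is real, so that A is self-adjoint. *)
Definition positive_op E (A : bop E E) : Prop := forall x, 0 <= '[A x, x].

(* Over R[i], a positive bounded operator has exactly one positive square root. *)
Definition bop_sqrt E (A : bop E E) : bop E E :=
  xget 0 [set B : bop E E | positive_op B /\ bop_comp B B = A].

Definition unitary_op E F (A : bop E F) : Prop :=
  bop_comp (adjoint A) A = bop_id E /\ bop_comp A (adjoint A) = bop_id F.

Lemma closure_range_submod E F (A : bop E F) :
  submod_closed (mem (closure (range A))).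
Proof.
have cl (y : F) : closure (range A) y <->
    forall e : C, 0 < e -> exists x, `|y - A x| < e.
  split=> [Ay e e0|Ay B].
    have [_ [[x _ <-] /=]] := Ay _ (nbhsx_ballx y e e0).
    by rewrite -ball_normE /= => yAx; exists x.
  rewrite -nbhs_ballE => -[e /= e0 yeB]; have [x yAx] := Ay e e0.
  by exists (A x); split; [exists x|apply: yeB; rewrite -ball_normE].
split=> [|a u v]; rewrite !inE/=.
  by apply: subset_closure; exists 0 => //; rewrite linear0.
move=> /cl Au /cl Av; apply/cl => e e0.
have e2 : 0 < e / 2 by rewrite divr_gt0.
have a1 : 0 < `|a| + 1 by rewrite ltr_wpDl.
have [x ux] := Au (e / 2 / (`|a| + 1)) (divr_gt0 e2 a1).
have [y vy] := Av (e / 2) e2; exists (a *: x + y).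
rewrite linearD linearZ/= opprD addrACA -scalerBr [e]splitr.
apply: le_lt_trans (ler_normD _ _) _; apply: ltr_leD; last exact: ltW.
rewrite normrZ; have [->|a0] := eqVneq a 0; first by rewrite normr0 mul0r.
move: ux; rewrite ltr_pdivlMr// mulrC; apply: le_lt_trans.
by rewrite ler_wpM2r// lerDl.
Qed.

Definition closed_range E F (A : bop E F) : closed_subspace F :=
  ClosedSubspace (closure_range_submod A) (@closed_closure _ _).

(* The unique operator V -> W acting as A, for A mapping V into W. *)
Definition bop_restrict E F (V : closed_subspace E) (W : closed_subspace F)
    (A : bop E F) : bop (subspace_type V) (subspace_type W) :=
  xget 0 [set B : bop (subspace_type V) (subspace_type W) |
          forall x, val (B x) = A (val x)].

End BopOps.

Arguments bop_id {C E}.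

Notation "A ∘ B" := (bop_comp A B) (at level 40, left associativity) :
  ring_scope.
Notation "A ^†" := (adjoint A) (at level 3, left associativity, format "A ^†") :
  ring_scope.
Notation "\Id" := bop_id (at level 0) : ring_scope.

Section RowOperators.
Variables (C : numClosedFieldType) (H : hilbertType C) (n : nat).
Implicit Types (T : 'I_n -> bop H H) (W : bop (hpow H n) H).

Lemma hpow_coord_linear (i : 'I_n) : linear (fun h : hpow H n => h i).
Proof. by move=> a x y; rewrite !ffunE. Qed.

Lemma hpow_coord_bounded (i : 'I_n) :
  exists M : C, forall h : hpow H n, `|h i| <= M * `|h|.
Proof. by exists 1 => h; rewrite mul1r; exact: ler_norm_coord. Qed.

Definition hpow_coord (i : 'I_n) : bop (hpow H n) H :=
  Bop (hpow_coord_linear i) (hpow_coord_bounded i).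

Definition hpow_inj_fun (i : 'I_n) (x : H) : hpow H n :=
  [ffun j => if j == i then x else 0].

Lemma hpow_inj_linear (i : 'I_n) : linear (hpow_inj_fun i).
Proof.
move=> a x y; apply/ffunP => j; rewrite !ffunE.
by case: ifP => // _; rewrite scaler0 addr0.
Qed.

Lemma hpow_inj_bounded (i : 'I_n) :
  exists M : C, forall x : H, `|hpow_inj_fun i x| <= M * `|x|.
Proof.
exists 1 => x; rewrite mul1r; apply: le_trans (ler_norm_sum _) _.
rewrite (bigD1 i)//= big1 ?addr0 => [|j /negPf ji]; rewrite ffunE ?eqxx//.
by rewrite ji normr0.
Qed.

Definition hpow_inj (i : 'I_n) : bop H (hpow H n) :=
  Bop (hpow_inj_linear i) (hpow_inj_bounded i).

Definition row_op T : bop (hpow H n) H := \sum_i T i ∘ hpow_coord i.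

Lemma row_opE T (h : hpow H n) : row_op T h = \sum_i T i (h i).
Proof. exact: bop_sumE. Qed.

Definition row_entry W (i : 'I_n) : bop H H := W ∘ hpow_inj i.

Lemma row_opK T i : row_entry (row_op T) i = T i.
Proof.
apply: bopP => x; rewrite [LHS]row_opE (bigD1 i)//= ffunE eqxx.
rewrite big1 ?addr0// => j /negPf ji.
by rewrite ffunE ji linear0.
Qed.

Definition scalar_row (z : 'cV[C]_n) : bop (hpow H n) H :=
  row_op (fun i => z i 0 *: \Id).

Definition commuting_contractive T : Prop :=
  (forall i j, T i ∘ T j = T j ∘ T i) /\
  positive_op (\Id - \sum_i T i ∘ (T i)^†).

End RowOperators.

Section Defect.
Variables (C : numClosedFieldType) (E F : hilbertType C).

(* For W = T : H^n -> H these are D_T and D_{T^*}. *)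
Definition defect (W : bop E F) : bop E E := bop_sqrt (\Id - W^† ∘ W).
Definition codefect (W : bop E F) : bop F F := bop_sqrt (\Id - W ∘ W^†).

End Defect.

Section Ball.
Variables (C : numClosedFieldType) (n : nat).
Implicit Types a z w : 'cV[C]_n.

Definition cdot z w : C := \sum_i z i 0 * (w i 0)^*.

Definition unit_ball : set 'cV[C]_n := [set z | cdot z z < 1].

(* The orthogonal projection onto C a; as 0^-1 = 0, the zero map for a = 0. *)
Definition line_proj a z : 'cV[C]_n := (cdot z a / cdot a a) *: a.

Definition ball_s a : C := sqrtC (1 - cdot a a).

Definition ball_aut a z : 'cV[C]_n :=
  (1 - cdot z a)^-1 *: (a - line_proj a z - ball_s a *: (z - line_proj a z)).

Lemma cdot_eq0 a : (cdot a a == 0) = (a == 0).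
Proof.
apply/eqP/eqP => [/eqP|->]; last by apply: big1 => i _; rewrite mxE mul0r.
rewrite psumr_eq0 => [/allP a0|i _]; last by rewrite -normCK exprn_ge0.
apply/colP => i; rewrite mxE; apply/eqP.
by have := a0 i (mem_index_enum i); rewrite -normCK sqrf_eq0 normr_eq0.
Qed.

Lemma line_proj_orth a z (c : C) : cdot (z - line_proj a z) (c *: a) = 0.
Proof.
have [->|a0] := eqVneq a 0.
  by rewrite scaler0; apply: big1 => i _; rewrite !mxE conjC0 mulr0.
have -> : cdot (z - line_proj a z) (c *: a) =
    c^* * (cdot z a - cdot z a / cdot a a * cdot a a).
  rewrite /cdot mulr_sumr -sumrB mulr_sumr; apply: eq_bigr => i _.
  by rewrite !mxE rmorphM/= mulrBl mulrBr !mulrA ![_ * c^*]mulrC !mulrA.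
by rewrite divfK ?subrr ?mulr0// cdot_eq0.
Qed.

End Ball.

Section AutomorphismTuples.
Variables (C : numClosedFieldType) (H : hilbertType C) (n : nat).
Implicit Types (T : 'I_n -> bop H H) (a : 'cV[C]_n) (u : 'M[C]_n).

(* The row operator P_a T. As 0^-1 = 0 it is 0 for a = 0, whence T_0 = - T. *)
Definition row_line_proj a T : bop (hpow H n) H :=
  (cdot a a)^-1 *: (row_op T ∘ (scalar_row H a)^† ∘ scalar_row H a).

Definition ball_aut_row a T : bop (hpow H n) H :=
  bop_inv (\Id - row_op T ∘ (scalar_row H a)^†) ∘
  (scalar_row H a - row_line_proj a T
     - ball_s a *: (row_op T - row_line_proj a T)).

Definition ball_aut_tuple a T : 'I_n -> bop H H :=
  row_entry (ball_aut_row a T).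

Definition unitary_tuple u T : 'I_n -> bop H H :=
  fun i => \sum_j u i j *: T j.

End AutomorphismTuples.

(* A triple {E, E_*, phi}; only the values of phi on the unit ball matter. *)
Record op_fun (C : numClosedFieldType) (n : nat) := OpFun {
  op_dom : hilbertType C;
  op_cod : hilbertType C;
  op_val :> 'cV[C]_n -> bop op_dom op_cod
}.

Section OpFun.
Variables (C : numClosedFieldType) (n : nat).
Implicit Types F G : op_fun C n.

Definition op_bounded F : Prop := exists M : C,
  forall z, unit_ball z -> forall x, `|F z x| <= M * `|x|.

Definition op_precomp F (g : 'cV[C]_n -> 'cV[C]_n) : op_fun C n :=
  OpFun (fun z => F (g z)).

Definition coincide_weakly F G : Prop :=
  [/\ op_bounded F, op_bounded G &
   exists2 tau : bop (op_cod F) (op_cod G), unitary_op tau &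
     forall z w, unit_ball z -> unit_ball w ->
       G w ∘ (G z)^† = tau ∘ (F w ∘ (F z)^†) ∘ tau^†].

(* The bracketed operator maps the closure of Ran D_T into the closure of     *)
(* Ran D_{T^*}, because T D_T = D_{T^*} T.                                    *)
Definition char_fun (H : hilbertType C) (T : 'I_n -> bop H H) : op_fun C n :=
  let W := row_op T in
  OpFun (fun z => let Z := scalar_row H z in
    bop_restrict (closed_range (defect W)) (closed_range (codefect W))
      (- W + codefect W ∘ bop_inv (\Id - Z ∘ W^†) ∘ Z ∘ defect W)).

End OpFun.

(* Main.v *)
(* Write W for the row operator of T, D for its codefect (1 - WW^* )^(1/2), Z for the
   row operator of z, and R_z = (1 - ZW^* )^(-1).  From W D_T = D W one gets
     1 - theta_T(w) theta_T(z)^* = (1 - <w,z>) D R_w R_z^* D.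
   With A, W' the row operators of a and u(T_a), K = s_a R_a and z' = u^* z, a direct
   computation gives
     1 - W' W'^* = K^* D^2 K   and   K R'_z = s_a / (1 - <z',a>) R_{phi_a(z')}.
   The first identity yields a unitary tau between the defect spaces sending D K x to
   D' x; by the second one and the formula for 1 - <phi_a(w'), phi_a(z')>, tau carries one
   kernel to the other. *)
Require Import Defs.
From mathcomp Require Import all_boot all_order all_algebra.
From mathcomp Require Import spectral sesquilinear complex.
From mathcomp Require Import boolp classical_sets reals topology normedtype.
From mathcomp Require Import sequences ring lra.

Set Implicit Arguments.
Unset Strict Implicit.
Unset Printing Implicit Defensive.

Import Order.TTheory GRing.Theory Num.Theory.
Import numFieldNormedType.Exports.

Local Open Scope ring_scope.
Local Open Scope sesquilinear_scope.

(** * Hilbert spaces *)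

(** Adjoints, inverses, square roots and restrictions are chosen by [xget] with default 0, so none
    of their equations is available before existence is shown: by Riesz for adjoints, by Neumann
    series for resolvents, by an iteration for square roots. That iteration is kept as a limit
    formula, because [W D_T = D W] comes from passing polynomials through [W]. The identities are
    tested on vectors through adjoints, which reduces them to algebra in a few inner products. Once
    the kernel identity is known, [u(T_a)] enters only through [W' W'^†] and the products [Z W'^†];
    there [u] either cancels or moves onto the point [z]. Invertibility of [K] is what makes [D K]
    and [D] have the same range, so that [tau] is defined on the whole defect space. *)

Section InnerProduct.
Variables (C : numClosedFieldType) (E : preHilbertType C).
Implicit Types x y z : E.

Lemma innerDl x y z : '[x + y, z] = '[x, z] + '[y, z].
Proof. exact: linearDl. Qed.

Lemma innerDr x y z : '[z, x + y] = '[z, x] + '[z, y].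
Proof. exact: linearDr. Qed.

Lemma innerNl x z : '[- x, z] = - '[x, z].
Proof. exact: linearNl. Qed.

Lemma innerNr x z : '[z, - x] = - '[z, x].
Proof. exact: linearNr. Qed.

Lemma innerZl a x z : '[a *: x, z] = a * '[x, z].
Proof. exact: linearZl_LR. Qed.

Lemma innerZr a x z : '[z, a *: x] = a^* * '[z, x].
Proof. exact: linearZr_LR. Qed.

Lemma inner0l z : '[0, z] = 0.
Proof. exact: linear0l. Qed.

Lemma inner0r z : '[z, 0] = 0.
Proof. exact: linear0r. Qed.

Lemma inner_conj x y : '[x, y]^* = '[y, x].
Proof. by rewrite [RHS]hermC expr0 mul1r. Qed.

End InnerProduct.

Definition innerE := (innerDl, innerDr, innerNl, innerNr, innerZl, innerZr).

Section Norm.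
Variables (C : numClosedFieldType) (E : preHilbertType C).
Implicit Types x y z : E.

Lemma normE x : `|x| = sqrtC '[x, x].
Proof. by rewrite -sqr_norm_inner sqrCK. Qed.

Lemma cauchy_schwarz x y : `|'[x, y]| <= `|x| * `|y|.
Proof. by rewrite !normE; exact: dnorm_CauchySchwarz. Qed.

Lemma inner_ext x y : (forall z, '[x, z] = '[y, z]) -> x = y.
Proof.
move=> xy; apply/eqP; rewrite -subr_eq0 -normr_eq0 -sqrf_eq0 sqr_norm_inner.
by rewrite innerDl innerNl xy subrr.
Qed.

Lemma inner_extr x y : (forall z, '[z, x] = '[z, y]) -> x = y.
Proof.
by move=> xy; apply: inner_ext => z; rewrite -inner_conj xy inner_conj.
Qed.

End Norm.

Lemma norm_le_inner (C : numClosedFieldType) (E F : preHilbertType C) (x : E) (y : F) :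
  (`|x| <= `|y|) = ('[x, x] <= '[y, y]).
Proof. by rewrite -!sqr_norm_inner ler_pXn2r ?nnegrE. Qed.

Section Completeness.
Variables (R : realType) (E : hilbertType R[i]).

(** The norm takes values in [R[i]]; its real part moves estimates to [R], where suprema, [lra] and
    [nra] apply. *)
Definition rnorm (x : E) : R := complex.Re `|x|.

Lemma rnormE x : `|x| = (rnorm x)%:C%C.
Proof. by rewrite RRe_real ?normr_real. Qed.

Lemma rnorm_ge0 x : 0 <= rnorm x.
Proof. by rewrite -ler0c -rnormE. Qed.

Lemma seq_complete (x : nat -> E) :
  (forall e : R, 0 < e -> exists N, forall m n, (N <= m)%N -> (N <= n)%N ->
     rnorm (x m - x n) < e) ->
  exists l, forall e : R, 0 < e ->
    exists N, forall n, (N <= n)%N -> rnorm (l - x n) < e.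
Proof.
move=> xc.
have /cvg_ex[l xl] : cvg (x @ \oo)%classic.
  apply: cauchy_cvg; apply/cauchy_ballP => e e0.
  have [|N xN] := xc (complex.Re e).
    by move: e0; rewrite ltcE => /andP[].
  near_simpl; exists ([set n | (N <= n)%N]%classic, [set n | (N <= n)%N]%classic) => /=.
    by split; exists N.
  move=> [m n] /= [Nm Nn]; rewrite -ball_normE /ball_/=.
  rewrite rnormE -[e]RRe_real ?gtr0_real// ltcR; exact: xN.
exists l => e e0.
have /cvgrPdist_lt/(_ e%:C%C) := xl; rewrite ltcR => /(_ e0) [N _ xN].
by exists N => n Nn; rewrite -ltcR -rnormE; exact: xN.
Qed.

End Completeness.

(** * The Riesz representation theorem *)

Section RealPart.
Variable R : realType.
Implicit Types (x y : R[i]) (r : R).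

Lemma ReD x y : complex.Re (x + y) = complex.Re x + complex.Re y.
Proof. by case: x y => ? ? []. Qed.

Lemma ReN x : complex.Re (- x) = - complex.Re x.
Proof. by case: x. Qed.

Lemma ReZ r x : complex.Re (r%:C%C * x) = r * complex.Re x.
Proof. by case: x => ? ? /=; rewrite mul0r subr0. Qed.

Lemma Re_conj x : complex.Re (x^*)%R = complex.Re x.
Proof. by case: x. Qed.

Lemma ge0_Re_eq x : 0 <= x -> x = (complex.Re x)%:C%C.
Proof. by move=> x0; rewrite RRe_real ?ger0_real. Qed.

Lemma ler_Re x y : x <= y -> complex.Re x <= complex.Re y.
Proof. by rewrite lecE => /andP[]. Qed.

Lemma Re_ge0 x : 0 <= x -> 0 <= complex.Re x.
Proof. exact: ler_Re. Qed.

Lemma ler_norm_Re x r : `|x| <= r%:C%C -> `|complex.Re x| <= r.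
Proof. by move=> /(le_trans (normc_ge_Re x)); rewrite lecR. Qed.

Lemma inv_nat_small (e : R) : 0 < e ->
  exists N, forall n, (N <= n)%N -> n.+1%:R^-1 < e.
Proof.
move=> e0; exists (Num.bound e^-1) => n Nn.
rewrite invf_plt ?posrE ?ltr0Sn// (lt_trans (archi_boundP _)) ?invr_ge0 ?ltW//.
by rewrite ltr_nat ltnS.
Qed.

End RealPart.

Section Riesz.
Variables (R : realType) (E : hilbertType R[i]).
Implicit Types x y z : E.

Lemma sqr_rnorm x : rnorm x ^+ 2 = complex.Re '[x, x].
Proof.
by apply: complexI; rewrite rmorphXn/= -rnormE sqr_norm_inner -ge0_Re_eq ?dnorm_ge0.
Qed.

Lemma rnorm_le x y : (rnorm x <= rnorm y) = (`|x| <= `|y|).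
Proof. by rewrite !rnormE lecR. Qed.

Lemma rnormD x y : rnorm (x + y) <= rnorm x + rnorm y.
Proof. by rewrite -lecR rmorphD/= -!rnormE ler_normD. Qed.

Lemma rnormN x : rnorm (- x) = rnorm x.
Proof. by rewrite /rnorm normrN. Qed.

Lemma rnormB x y : rnorm (x - y) = rnorm (y - x).
Proof. by rewrite -rnormN opprB. Qed.

Lemma rnorm_eq0 x : rnorm x = 0 -> x = 0.
Proof. by move=> x0; apply/eqP; rewrite -normr_eq0 rnormE x0. Qed.

Lemma rnormZ (r : R) x : rnorm (r%:C%C *: x) = `|r| * rnorm x.
Proof.
by apply: complexI; rewrite rmorphM/= -!rnormE normrZ normc_def/= expr0n addr0 sqrtr_sqr.
Qed.

Lemma Re_cauchy_schwarz x y : `|complex.Re '[x, y]| <= rnorm x * rnorm y.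
Proof. by apply: ler_norm_Re; rewrite rmorphM/= -!rnormE; exact: cauchy_schwarz. Qed.

(** Variational proof: [J x = |x|^2 - 2 Re (f x)] is bounded below, and the parallelogram identity
    [JM] makes a minimizing sequence Cauchy. At its limit the first variation vanishes, which gives
    the real part of the claim; ['i *: h] in place of [h] gives the imaginary part. *)
Lemma riesz (f : E -> R[i]) : (forall a x y, f (a *: x + y) = a * f x + f y) ->
  (exists M, forall x, `|f x| <= M * `|x|) -> exists y, forall x, f x = '[x, y].
Proof.
move=> fl [M fM].
have f0 : f 0 = 0.
  by have := fl 1 0 0; rewrite scale1r addr0 mul1r => /esym/(canRL (addKr _)); rewrite addNr.
have fD x y : f (x + y) = f x + f y by rewrite -[x in LHS]scale1r fl mul1r.
have fZ a x : f (a *: x) = a * f x by rewrite -[_ *: x in LHS]addr0 fl f0 addr0.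
have {M fM}[m fm] : exists m : R, forall x, `|complex.Re (f x)| <= m * rnorm x.
  exists (complex.Re M) => x.
  have -> : complex.Re M * rnorm x = complex.Re (M * `|x|).
    by rewrite rnormE [M * _]mulrC ReZ mulrC.
  by apply: ler_norm_Re; rewrite -ge0_Re_eq//; apply: le_trans (fM x).
pose J x := rnorm x ^+ 2 - 2 * complex.Re (f x).
have Jlb x : - m ^+ 2 <= J x.
  have := fm x; rewrite ler_norml => /andP[_]; rewrite /J.
  by move=> h; have := sqr_ge0 (rnorm x - m); nra.
pose S := range J; have Sinf : has_inf S.
  split; first by exists (J 0), 0.
  by exists (- m ^+ 2) => _ [x _ <-].
pose d := inf S.
have dJ x : d <= J x by apply: (inf_lbound Sinf.2); exists x.
have /choice[s sd] : forall k : nat, exists x, J x < d + k.+1%:R^-1.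
  move=> k; have k0 : 0 < k.+1%:R^-1 :> R by rewrite invr_gt0.
  by have [_ [x _ <-]] := inf_adherent k0 Sinf; exists x.
have JD x (t : R) h : J (x + t%:C%C *: h) = J x + 2 * t * complex.Re ('[x, h] - f h)
    + t ^+ 2 * rnorm h ^+ 2.
  rewrite /J !sqr_rnorm fD fZ !innerE !ReD ReN !ReZ.
  rewrite -[_^*]/(t%:C%C^*)%C conjc_real !ReZ.
  by rewrite -[in '[h, x]]inner_conj Re_conj; ring.
have JM x y : rnorm (x - y) ^+ 2 = 2 * J x + 2 * J y - 4 * J ((2^-1)%:C%C *: (x + y)).
  rewrite /J !sqr_rnorm fZ fD !innerE -[_^*]/((2^-1)%:C%C^*)%C conjc_real.
  by rewrite !(ReD, ReN, ReZ); field.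
have [|l sl] := @seq_complete R E s.
  move=> e e0; have e4 : 0 < e ^+ 2 / 4 by rewrite divr_gt0 ?exprn_gt0.
  have [N NP] := inv_nat_small e4; exists N => i j /NP Ni /NP Nj.
  rewrite -(ltr_pXn2r (n := 2%N)) ?nnegrE ?rnorm_ge0 ?ltW//.
  have := JM (s i) (s j); have := dJ ((2^-1)%:C%C *: (s i + s j)).
  have := sd i; have := sd j; move: Ni Nj; clearbody J.
  move: (i.+1%:R^-1) (j.+1%:R^-1) (e ^+ 2) (J _) (J _) (J _) (_ ^+ 2) => *.
  by lra.
have Re0 h : complex.Re ('[l, h] - f h) = 0.
  set c := complex.Re _; set Q := rnorm h ^+ 2.
  have Q0 : 0 <= Q by exact: sqr_ge0.
  have tP (t : R) : 0 <= 2 * t * c + t ^+ 2 * Q.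
    rewrite leNgt; apply/negP; set v := _ + _ => v0.
    pose p := `|t| * rnorm h; have p0 : 0 <= p by rewrite mulr_ge0 ?rnorm_ge0.
    (* The margin [e] is such that replacing [l] by a late term [s k] costs at most
       [e + 2 * e * p = - v / 2], so [J (s k + t h)] would fall below the infimum [d]. *)
    have [e e0 vE] : exists2 e : R, 0 < e & v = - (e * (2 * (1 + 2 * p))).
      have K0 : 0 < 2 * (1 + 2 * p).
        by apply: mulr_gt0 => //; apply: ltr_pwDl => //; exact: mulr_ge0.
      exists (- v / (2 * (1 + 2 * p))); first by rewrite divr_gt0 ?oppr_gt0.
      by rewrite divfK ?opprK ?gt_eqF.
    have [N1 P1] := inv_nat_small e0; have [N2 P2] := sl _ e0.
    pose k := maxn N1 N2; have := P1 k (leq_maxl _ _); have := P2 k (leq_maxr _ _).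
    move=> /ltW le ke.
    have : t * complex.Re '[s k - l, h] <= e * p.
      rewrite (le_trans (ler_norm _))// normrM /p mulrCA ler_wpM2l//.
      by rewrite (le_trans (Re_cauchy_schwarz _ _))// ler_wpM2r ?rnorm_ge0// rnormB.
    have := mulr_ge0 (ltW e0) p0; move: (dJ (s k + t%:C%C *: h)); rewrite JD.
    move: (sd k) ke vE e0; rewrite /v /c !innerE !ReD !ReN -/Q.
    move: (k.+1%:R^-1) (J _) (complex.Re '[s k, h]) (complex.Re '[l, h]) (complex.Re (f h)).
    by clear; move: Q d p => Q d p *; nra.
  (* Close to the minimizer [- c / Q] of the quadratic, with [Q + 1] to allow [h = 0]. *)
  have := tP (- c / (Q + 1)).
  have -> : 2 * (- c / (Q + 1)) * c + (- c / (Q + 1)) ^+ 2 * Q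
     = - (c ^+ 2 * (Q + 2) / (Q + 1) ^+ 2) by field; rewrite gt_eqF//; lra.
  rewrite oppr_ge0 => h1.
  have : c ^+ 2 * ((Q + 2) / (Q + 1) ^+ 2) <= 0 by rewrite mulrA.
  rewrite pmulr_lle0; last by rewrite divr_gt0 ?exprn_gt0//; lra.
  by move=> c0; apply/eqP; rewrite -sqrf_eq0 eq_le c0 sqr_ge0.
exists l => h; rewrite -inner_conj.
have := Re0 h; have := Re0 ('i%C *: h); rewrite fZ innerZr !ReD !ReN.
case: (f h) '[l, h] => [p q] [r s'] /= h1 h2.
by apply/eqP; rewrite eq_complex /=; apply/andP; split; apply/eqP; lra.
Qed.

End Riesz.

(** * Adjoints and positive operators *)

Section Composition.
Variable C : numClosedFieldType.
Implicit Types E F G K : hilbertType C.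

Lemma bop_compE E F G (A : bop F G) (B : bop E F) x : (A ∘ B) x = A (B x).
Proof. by []. Qed.

Lemma bop_idE E (x : E) : (\Id : bop E E) x = x.
Proof. by []. Qed.

Lemma bop_mapD E F (A : bop E F) x y : A (x + y) = A x + A y.
Proof. exact: linearD. Qed.

Lemma bop_mapN E F (A : bop E F) x : A (- x) = - A x.
Proof. exact: linearN. Qed.

Lemma bop_mapZ E F (A : bop E F) a x : A (a *: x) = a *: A x.
Proof. exact: linearZ. Qed.

Lemma bop_map0 E F (A : bop E F) : A 0 = 0.
Proof. exact: linear0. Qed.

Lemma bop_compA E F G K (A : bop G K) (B : bop F G) (D : bop E F) :
  A ∘ (B ∘ D) = A ∘ B ∘ D.
Proof. exact: bopP. Qed.

Lemma bop_compDl E F G (A B : bop F G) (D : bop E F) : (A + B) ∘ D = A ∘ D + B ∘ D.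
Proof. exact: bopP. Qed.

Lemma bop_compDr E F G (A B : bop E F) (D : bop F G) : D ∘ (A + B) = D ∘ A + D ∘ B.
Proof. by apply: bopP => x; rewrite bop_compE !bopDE linearD. Qed.

Lemma bop_compNl E F G (A : bop F G) (D : bop E F) : (- A) ∘ D = - (A ∘ D).
Proof. exact: bopP. Qed.

Lemma bop_compNr E F G (A : bop E F) (D : bop F G) : D ∘ (- A) = - (D ∘ A).
Proof. by apply: bopP => x; rewrite bop_compE !bopNE linearN. Qed.

Lemma bop_compZl E F G a (A : bop F G) (D : bop E F) : (a *: A) ∘ D = a *: (A ∘ D).
Proof. exact: bopP. Qed.

Lemma bop_compZr E F G a (A : bop E F) (D : bop F G) : D ∘ (a *: A) = a *: (D ∘ A).
Proof. by apply: bopP => x; rewrite bop_compE !bopZE linearZ. Qed.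

Lemma bop_comp1l E F (A : bop E F) : \Id ∘ A = A.
Proof. exact: bopP. Qed.

Lemma bop_comp1r E F (A : bop E F) : A ∘ \Id = A.
Proof. exact: bopP. Qed.

Lemma bop_bounded_ge0 E F (A : bop E F) :
  exists2 M : C, 0 <= M & forall x, `|A x| <= M * `|x|.
Proof.
have [M AM] := bop_bounded A; exists `|M| => // x.
by have := AM x => Ax; rewrite -[`|x|]normr_id -normrM ger0_norm ?(le_trans _ Ax).
Qed.

Lemma bop_invP E (A : bop E E) : (exists B, A ∘ B = \Id /\ B ∘ A = \Id) ->
  A ∘ bop_inv A = \Id /\ bop_inv A ∘ A = \Id.
Proof.
by move=> [B AB]; rewrite /bop_inv; case: xgetP => [D _ //|/(_ B)/(_ AB)].
Qed.

Lemma bop_inv_eq E (A B : bop E E) : A ∘ B = \Id -> B ∘ A = \Id -> bop_inv A = B.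
Proof.
move=> AB BA; have [|_ IA] := @bop_invP E A; first by exists B.
by rewrite -[LHS]bop_comp1r -AB bop_compA IA bop_comp1l.
Qed.

End Composition.

Definition bopE := (bop_compE, bop_idE, bopDE, bopNE, bop0E, bopZE).

Section Adjoint.
Variable R : realType.
Local Notation C := R[i].
Implicit Types E F G : hilbertType C.

(** Riesz represents [x |-> '[A x, y]] for each [y]. The representing vector is unique, hence linear
    in [y] up to the conjugation built into the inner product, and [|B y|^2 = '[A (B y), y]] bounds
    it. *)
Lemma adjointP E F (A : bop E F) x y : '[A x, y] = '[x, A^† y].
Proof.
have [M M0 AM] := bop_bounded_ge0 A.
have /choice[B BP] : forall y, exists z, forall x, '[A x, y] = '[x, z].
  move=> z; apply: riesz => [a u v|]; first by rewrite linearP innerDl innerZl.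
  exists (M * `|z|) => u; rewrite mulrAC.
  by apply: le_trans (cauchy_schwarz _ _) _; apply: ler_wpM2r; rewrite ?AM.
have Bl : linear B.
  by move=> a u v; apply: inner_extr => w; rewrite innerDr innerZr -!BP innerDr innerZr.
have Bb : exists M : C, forall x, `|B x| <= M * `|x|.
  exists M => u; have [->|Bu0] := eqVneq (B u) 0; first by rewrite normr0 mulr_ge0.
  rewrite -(@ler_pM2r _ `|B u|) ?normr_gt0// -expr2 sqr_norm_inner -BP.
  apply: le_trans (_ : `|'[A (B u), u]| <= _).
    by rewrite real_ler_norm// BP -sqr_norm_inner rpredX ?normr_real.
  apply: le_trans (cauchy_schwarz _ _) _.
  by rewrite mulrAC; apply: ler_wpM2r; rewrite ?AM.
have BB : [set B : bop F E | forall x y, '[A x, y] = '[x, B y]]%classic (Bop Bl Bb).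
  by move=> u v /=.
rewrite /adjoint; case: xgetP => [D _ /(_ x y)//|/(_ (Bop Bl Bb))/(_ BB)//].
Qed.

Lemma adjointPr E F (A : bop E F) x y : '[x, A y] = '[A^† x, y].
Proof. by rewrite -inner_conj adjointP inner_conj. Qed.

Lemma adjoint_eq E F (A : bop E F) (B : bop F E) :
  (forall x y, '[A x, y] = '[x, B y]) -> A^† = B.
Proof. by move=> AB; apply: bopP => y; apply: inner_extr => x; rewrite -AB adjointP. Qed.

Lemma adjointK E F (A : bop E F) : A^†^† = A.
Proof. by apply: adjoint_eq => x y; rewrite adjointPr. Qed.

Lemma adjoint_comp E F G (A : bop F G) (B : bop E F) : (A ∘ B)^† = B^† ∘ A^†.
Proof. by apply: adjoint_eq => x y; rewrite !bopE !adjointP. Qed.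

Lemma adjointD E F (A B : bop E F) : (A + B)^† = A^† + B^†.
Proof. by apply: adjoint_eq => x y; rewrite !bopE innerDl innerDr !adjointP. Qed.

Lemma adjointN E F (A : bop E F) : (- A)^† = - A^†.
Proof. by apply: adjoint_eq => x y; rewrite !bopE innerNl innerNr !adjointP. Qed.

Lemma adjointZ E F a (A : bop E F) : (a *: A)^† = a^* *: A^†.
Proof.
by apply: adjoint_eq => x y; rewrite !bopE innerZl innerZr conjCK adjointP.
Qed.

Lemma adjoint_id E : (\Id : bop E E)^† = \Id.
Proof. exact: adjoint_eq. Qed.

Lemma adjoint_sum E F I (r : seq I) (P : pred I) (A : I -> bop E F) :
  (\sum_(i <- r | P i) A i)^† = \sum_(i <- r | P i) (A i)^†.
Proof.
elim/big_rec2: _ => [|i a b _ <-]; last by rewrite adjointD.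
by apply: adjoint_eq => x y; rewrite !bopE inner0l inner0r.
Qed.

Lemma adjoint_bound E F (A : bop E F) (M : C) : 0 <= M ->
  (forall x, `|A x| <= M * `|x|) -> forall y, `|A^† y| <= M * `|y|.
Proof.
move=> M0 AM u; have [->|Bu0] := eqVneq (A^† u) 0; first by rewrite normr0 mulr_ge0.
rewrite -(@ler_pM2r _ `|A^† u|) ?normr_gt0// -expr2 sqr_norm_inner -adjointP.
apply: le_trans (_ : `|'[A (A^† u), u]| <= _).
  by rewrite real_ler_norm// adjointP -sqr_norm_inner rpredX ?normr_real.
apply: le_trans (cauchy_schwarz _ _) _.
by rewrite mulrAC; apply: ler_wpM2r; rewrite ?AM.
Qed.

Definition contractive E F (A : bop E F) := forall x, `|A x| <= `|x|.

Lemma contractive_adjoint E F (A : bop E F) : contractive A -> contractive A^†.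
Proof.
by move=> cA x; rewrite -[leRHS]mul1r; apply: adjoint_bound => // y; rewrite mul1r.
Qed.

Lemma contractive_comp E F G (A : bop F G) (B : bop E F) :
  contractive A -> contractive B -> contractive (A ∘ B).
Proof. by move=> cA cB x; apply: le_trans (cA _) (cB _). Qed.

Lemma contractive_positive E F (A : bop E F) :
  contractive A <-> positive_op (\Id - A^† ∘ A).
Proof.
split=> cA x; have := cA x; rewrite !bopE innerDl innerNl -adjointPr subr_ge0.
  by rewrite norm_le_inner.
by rewrite -norm_le_inner.
Qed.

(* Polarization: this fails over the real scalars. *)
Lemma quadratic_form_eq0 E (A : bop E E) : (forall x, '[A x, x] = 0) -> A = 0.
Proof.
move=> A0; apply: bopP => x; apply: inner_ext => y; rewrite inner0l.
have := A0 (x + y); have := A0 (x + 'i *: y).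
rewrite !bop_mapD !bop_mapZ !innerE !A0 conjCi !(add0r, addr0, mulr0) => h1 h2.
have h3 : '[A x, y] = '[A y, x].
  apply: (mulfI (neq0Ci C)); apply/eqP; rewrite -subr_eq0 -oppr_eq0 opprB.
  by rewrite addrC -mulNr h1.
by move/eqP: h2; rewrite h3 -mulr2n mulrn_eq0 => /eqP.
Qed.

Lemma positive_selfadjoint E (A : bop E E) : positive_op A -> A^† = A.
Proof.
move=> pA; apply/eqP; rewrite -subr_eq0; apply/eqP/quadratic_form_eq0 => x.
rewrite !bopE innerDl innerNl -adjointPr -inner_conj geC0_conj ?pA//.
exact: subrr.
Qed.

End Adjoint.

(** * Limits and Neumann series *)

Section Limits.
Variable R : realType.
Local Notation C := R[i].
Implicit Types E F : hilbertType C.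
Local Open Scope classical_set_scope.

Lemma cvg_rnormP E (x : nat -> E) l : x @ \oo --> l <->
  forall e : R, 0 < e -> exists N, forall n, (N <= n)%N -> rnorm (l - x n) < e.
Proof.
split=> [xl e e0|xl].
  have /cvgrPdist_lt/(_ e%:C%C) := xl; rewrite ltcR => /(_ e0) [N _ xN].
  by exists N => n Nn; rewrite -ltcR -rnormE; exact: xN.
apply/cvgrPdist_lt => e e0; have [|N xN] := xl (complex.Re e).
  by move: e0; rewrite ltcE => /andP[].
exists N => // n /= Nn; rewrite rnormE -[e]RRe_real ?gtr0_real// ltcR; exact: xN.
Qed.

(** The increments of [x] telescope against those of [b], so from an index where [b] is within
    [e / 2] of its supremum on, [x] moves by less than [e / 2]. Both the Neumann series and the
    square root iteration converge by this criterion. *)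
Lemma summable_cvg E (x : nat -> E) (b : nat -> R) (B : R) :
  (forall k, rnorm (x k.+1 - x k) <= b k.+1 - b k) -> (forall k, b k <= B) ->
  exists l : E, x @ \oo --> l.
Proof.
move=> xb bB.
have xb_le m k : rnorm (x (m + k)%N - x m) <= b (m + k)%N - b m.
  elim: k => [|k IH]; first by rewrite addn0 !subrr /rnorm normr0.
  rewrite addnS -[x _ - _](subrKA (x (m + k)%N)) -[b _ - _](subrKA (b (m + k)%N)).
  by apply: le_trans (rnormD _ _) _; exact: lerD (xb _) IH.
have S : has_sup (range b) by split; [exists (b 0%N), 0%N|exists B => _ [k _ <-]].
suff [l xl] : exists l, forall e : R, 0 < e ->
    exists N, forall n, (N <= n)%N -> rnorm (l - x n) < e.
  by exists l; apply/cvg_rnormP.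
apply: seq_complete => e e0.
have e2 : 0 < e / 2 by rewrite divr_gt0.
have [_ [N _ <-] bN] := sup_adherent e2 S.
exists N => m n Nm Nn.
have bs k : b k <= sup (range b) by apply: (sup_upper_bound S); exists k.
have xN k : (N <= k)%N -> rnorm (x k - x N) < e / 2.
  move=> Nk; have := xb_le N (k - N)%N; rewrite subnKC// => xk.
  by have := bs k; lra.
rewrite -[x m - _](subrKA (x N)) [ltRHS]splitr.
by apply: le_lt_trans (rnormD _ _) _; rewrite ltrD ?xN// rnormB xN.
Qed.

Lemma bop_cvg E F (A : bop E F) (x : nat -> E) l : x @ \oo --> l ->
  (fun k => A (x k)) @ \oo --> A l.
Proof.
move=> /cvgrPdist_lt xl; have [M M0 AM] := bop_bounded_ge0 A.
have M1 : 0 < M + 1 by rewrite ltr_wpDl.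
apply/cvgrPdist_lt => e e0; have := xl _ (divr_gt0 e0 M1); apply: filterS => k xk.
rewrite -bop_mapN -bop_mapD; apply: le_lt_trans (AM _) _.
apply: (@le_lt_trans _ _ ((M + 1) * `|l - x k|)); first by rewrite ler_wpM2r ?lerDl.
by rewrite mulrC -ltr_pdivlMr.
Qed.

Lemma cvg_innerl E (x : nat -> E) l y : x @ \oo --> l ->
  (fun k => '[x k, y]) @ \oo --> '[l, y].
Proof.
move=> /cvgrPdist_lt xl.
have M1 : 0 < `|y| + 1 by rewrite ltr_wpDl.
apply/cvgrPdist_lt => e e0; have := xl _ (divr_gt0 e0 M1); apply: filterS => k xk.
rewrite -innerNl -innerDl; apply: le_lt_trans (cauchy_schwarz _ _) _.
apply: (@le_lt_trans _ _ (`|l - x k| * (`|y| + 1))); first by rewrite ler_wpM2l ?lerDl.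
by rewrite -ltr_pdivlMr.
Qed.

Lemma cvg_innerr E (x : nat -> E) l y : x @ \oo --> l ->
  (fun k => '[y, x k]) @ \oo --> '[y, l].
Proof.
move=> /cvgrPdist_lt xl.
have M1 : 0 < `|y| + 1 by rewrite ltr_wpDl.
apply/cvgrPdist_lt => e e0; have := xl _ (divr_gt0 e0 M1); apply: filterS => k xk.
rewrite -innerNr -innerDr; apply: le_lt_trans (cauchy_schwarz _ _) _.
apply: (@le_lt_trans _ _ ((`|y| + 1) * `|l - x k|)); first by rewrite ler_wpM2r ?lerDl.
by rewrite mulrC -ltr_pdivlMr.
Qed.

Lemma cvg_norm_bound E (x : nat -> E) l (M : C) : x @ \oo --> l ->
  (forall k, `|x k| <= M) -> `|l| <= M.
Proof.
move=> /cvgrPdist_lt xl xM.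
have Mr : M \is Num.real by apply: ger0_real; apply: le_trans (xM 0%N).
rewrite real_leNgt ?normr_real//; apply/negP => lM.
have [|N _ /(_ N (leqnn _)) lN] := xl (`|l| - M); first by rewrite subr_gt0.
have := ler_normD (l - x N) (x N); rewrite subrK; apply/negP.
by rewrite -real_ltNge ?realD ?normr_real// -[ltRHS](subrK M) ltr_leD.
Qed.

Lemma seq_cvg_unique E (x : nat -> E) (l l' : E) : x @ \oo --> l -> x @ \oo --> l' -> l = l'.
Proof. exact: norm_cvg_unique. Qed.

Lemma limit_bop E F (A : nat -> bop E F) (M : C) :
  (forall k x, `|A k x| <= M * `|x|) ->
  (forall x, exists l : F, (fun k => A k x) @ \oo --> l) ->
  exists L : bop E F, forall x, (fun k => A k x) @ \oo --> L x.
Proof.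
move=> AM /choice[L AL].
have Ll : linear L.
  move=> a x y; apply: (@seq_cvg_unique _ (fun k => A k (a *: x + y))) => //.
  rewrite (_ : (fun k => _) = (fun k => a *: A k x + A k y)); last first.
    by apply/funext => k; rewrite linearP.
  by apply: cvgD => //; apply: cvgZr.
have Lb : exists M : C, forall x, `|L x| <= M * `|x|.
  by exists M => x; apply: (cvg_norm_bound (AL x)).
by exists (Bop Ll Lb).
Qed.

(** Surjectivity of [\Id - X] comes from the iteration [s (k+1) = y + X (s k)]. The lower bound
    [below] gives injectivity, from which linearity of the inverse follows, and also its
    boundedness. *)
Lemma neumann E (X : bop E E) (r : R) : 0 <= r < 1 ->
  (forall x, rnorm (X x) <= r * rnorm x) ->
  (\Id - X) ∘ bop_inv (\Id - X) = \Id /\ bop_inv (\Id - X) ∘ (\Id - X) = \Id.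
Proof.
move=> /andP[r0 r1] Xr; apply: bop_invP.
have r1' : 0 < 1 - r by rewrite subr_gt0.
have below x : rnorm x <= (1 - r)^-1 * rnorm ((\Id - X) x).
  rewrite mulrC ler_pdivlMr//.
  have := rnormD ((\Id - X) x) (X x); rewrite !bopE subrK => h.
  by have := Xr x; lra.
have /choice[B BP] : forall y, exists x, (\Id - X) x = y.
  move=> y; pose s := fix s k := if k is k'.+1 then y + X (s k') else 0.
  have sS k : s k.+1 = y + X (s k) by [].
  have sr k : rnorm (s k.+1 - s k) <= r ^+ k * rnorm y.
    elim: k => [|k IH]; first by rewrite sS /= bop_map0 addr0 subr0 expr0 mul1r.
    rewrite !sS opprD addrACA subrr add0r -bop_mapN -bop_mapD exprS -mulrA.
    by apply: le_trans (Xr _) _; apply: ler_wpM2l.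
  (* The dominating sequence consists of the partial sums of the geometric series. *)
  have [||l sl] := @summable_cvg _ s (fun k => (1 - r ^+ k) / (1 - r) * rnorm y)
     ((1 - r)^-1 * rnorm y).
  - move=> k; apply: le_trans (sr k) _; rewrite le_eqVlt; apply/orP; left; apply/eqP.
    by rewrite exprS; field; rewrite gt_eqF.
  - move=> k; apply: ler_wpM2r; first exact: rnorm_ge0.
    by rewrite ler_pdivrMr// mulVf ?gt_eqF// gerBl exprn_ge0.
  exists l; have : l = y + X l.
    apply: (@seq_cvg_unique _ s) => //.
    rewrite -(cvg_shiftS s); apply: cvgD; [exact: cvg_cst|exact: bop_cvg].
  by rewrite !bopE => {1}->; rewrite addrK.
have inj x y : (\Id - X) x = (\Id - X) y -> x = y.
  move=> xy; apply/eqP; rewrite -subr_eq0; apply/eqP/rnorm_eq0/eqP.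
  rewrite eq_le rnorm_ge0 andbT (le_trans (below _))// bop_mapD bop_mapN xy subrr.
  by rewrite /rnorm normr0 mulr0.
have Bl : linear B.
  by move=> a x y; apply: inj; rewrite bop_mapD bop_mapZ !BP.
have Bb : exists M : C, forall x, `|B x| <= M * `|x|.
  exists (1 - r)^-1%:C%C => x; rewrite !rnormE -rmorphM/= lecR.
  by have := below (B x); rewrite BP.
exists (Bop Bl Bb); split; apply: bopP => x; first exact: BP.
by apply: inj; rewrite [LHS]BP.
Qed.

End Limits.

(** * Square roots and defect operators *)

Section SquareRoot.
Variable R : realType.
Local Notation C := R[i].
Implicit Types E F : hilbertType C.
Local Open Scope classical_set_scope.

(* Iterates for the fixed point Y = (X + Y^2) / 2, that is Y = 1 - (1 - X)^(1/2). *)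
Fixpoint sqrt_iter E (X : bop E E) k : bop E E :=
  if k is k'.+1 then 2^-1 *: (X + sqrt_iter X k' ∘ sqrt_iter X k') else 0.

(* The scalar iteration at X = 1: its increments dominate those for a contraction X. *)
Fixpoint sqrt_iter_bound k : R :=
  if k is k'.+1 then 2^-1 * (1 + sqrt_iter_bound k' ^+ 2) else 0.

Lemma sqrt_iterS E (X : bop E E) k :
  sqrt_iter X k.+1 = 2^-1 *: (X + sqrt_iter X k ∘ sqrt_iter X k).
Proof. by []. Qed.

Lemma sqrt_iter_boundS k : sqrt_iter_bound k.+1 = 2^-1 * (1 + sqrt_iter_bound k ^+ 2).
Proof. by []. Qed.

Lemma sqrt_iter_bound_itv k : 0 <= sqrt_iter_bound k <= 1.
Proof. by elim: k => [|k /andP[? ?]] /=; apply/andP; split; nra. Qed.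

(** Each iterate is the same polynomial in [X] as in [X']. In the limit this yields the intertwining
    of square roots, and with [Z] in [B(E)] the commutation needed for their uniqueness. *)
Lemma sqrt_iter_intertwine E F (X : bop E E) (X' : bop F F) (Z : bop E F) k :
  Z ∘ X = X' ∘ Z -> Z ∘ sqrt_iter X k = sqrt_iter X' k ∘ Z.
Proof.
move=> ZX; elim: k => [|k IH] /=; first by apply: bopP => x; rewrite !bopE bop_map0.
rewrite bop_compZr bop_compZl bop_compDr bop_compDl ZX.
by rewrite bop_compA IH -bop_compA IH bop_compA.
Qed.

Lemma sqrt_iter_selfadjoint E (X : bop E E) k : X^† = X ->
  (sqrt_iter X k)^† = sqrt_iter X k.
Proof.
move=> XX; elim: k => [|k IH] /=.
  by apply: adjoint_eq => x y; rewrite !bopE inner0l inner0r.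
by rewrite adjointZ adjointD adjoint_comp IH XX geC0_conj// invr_ge0.
Qed.

Lemma rnorm_contractive E F (A : bop E F) x : contractive A -> rnorm (A x) <= rnorm x.
Proof. by move=> cA; apply: ler_Re; exact: cA. Qed.

Lemma rnorm_half E (x : E) : rnorm (2^-1 *: x) = 2^-1 * rnorm x.
Proof.
have -> : (2^-1 : C) = (2^-1)%:C%C by rewrite fmorphV rmorph_nat.
by rewrite rnormZ ger0_norm// invr_ge0.
Qed.

Lemma sqrt_iter_bounded E (X : bop E E) k x : contractive X ->
  rnorm (sqrt_iter X k x) <= sqrt_iter_bound k * rnorm x.
Proof.
move=> cX; elim: k x => [|k IH] x; first by rewrite mul0r /rnorm normr0.
rewrite sqrt_iterS sqrt_iter_boundS !bopE rnorm_half -mulrA ler_pM2l ?invr_gt0// mulrDl mul1r.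
apply: le_trans (rnormD _ _) _; apply: lerD; first exact: rnorm_contractive.
have /andP[y0 _] := sqrt_iter_bound_itv k.
by apply: le_trans (IH _) _; rewrite expr2 -mulrA ler_wpM2l.
Qed.

(** Commuting iterates give [Y (k+2) - Y (k+1) = (Y (k+1) + Y k) (Y (k+1) - Y k) / 2]. The scalar
    sequence satisfies the same identity, so the domination propagates factor by factor. *)
Lemma sqrt_iter_step E (X : bop E E) k x : contractive X ->
  rnorm ((sqrt_iter X k.+1 - sqrt_iter X k) x) <=
  (sqrt_iter_bound k.+1 - sqrt_iter_bound k) * rnorm x.
Proof.
move=> cX; elim: k x => [|k IH] x.
  rewrite sqrt_iterS sqrt_iter_boundS expr0n addr0 mulr1 [sqrt_iter X 0]/= !subr0.
  rewrite !bopE rnorm_half addr0.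
  by rewrite ler_pM2l ?invr_gt0//; exact: rnorm_contractive.
set Y := sqrt_iter X in IH *; set y := sqrt_iter_bound in IH *.
have YY : Y k.+1 ∘ Y k = Y k ∘ Y k.+1.
  (* Used twice: [X] commutes with itself, hence with every iterate, hence the iterates commute with
     each other. *)
  by apply: sqrt_iter_intertwine; apply/esym/sqrt_iter_intertwine.
have -> : Y k.+2 - Y k.+1 = 2^-1 *: ((Y k.+1 + Y k) ∘ (Y k.+1 - Y k)).
  rewrite /Y 2!sqrt_iterS -/Y -scalerBr; congr (_ *: _).
  rewrite bop_compDl !bop_compDr !bop_compNr YY.
  by rewrite subrKA opprD addrACA subrr add0r.
have -> : y k.+2 - y k.+1 = 2^-1 * ((y k.+1 + y k) * (y k.+1 - y k)).
  by rewrite /y 2!sqrt_iter_boundS -/y; ring.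
rewrite bopZE rnorm_half -!mulrA ler_pM2l ?invr_gt0// bop_compE.
have /andP[y0 _] := sqrt_iter_bound_itv k; have /andP[y1 _] := sqrt_iter_bound_itv k.+1.
apply: (@le_trans _ _ ((y k.+1 + y k) * rnorm ((Y k.+1 - Y k) x))); last first.
  by apply: ler_wpM2l; rewrite ?addr_ge0// IH.
rewrite bopDE mulrDl; apply: le_trans (rnormD _ _) _.
by apply: lerD; exact: sqrt_iter_bounded.
Qed.

(** The pointwise limit [L] satisfies [L = (X + L^2) / 2], that is [(1 - L)^2 = 1 - X], and [1 - L]
    is positive because [L] is a self-adjoint contraction. *)
Lemma sqrt_contractive_exists E (X : bop E E) : contractive X -> X^† = X ->
  exists S, [/\ positive_op S, S ∘ S = \Id - X &
    forall x, (fun k => sqrt_iter X k x) @ \oo --> x - S x].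
Proof.
move=> cX XX; pose Y := sqrt_iter X.
have cY k : contractive (Y k).
  move=> x; rewrite -rnorm_le; apply: le_trans (sqrt_iter_bounded k x cX) _.
  have /andP[_ y1] := sqrt_iter_bound_itv k.
  by rewrite -[leRHS]mul1r ler_wpM2r ?rnorm_ge0.
have [k x||L YL] := @limit_bop R E E Y 1.
- by rewrite mul1r; exact: cY.
- move=> x; apply: (@summable_cvg _ _ _ (fun k => sqrt_iter_bound k * rnorm x) (rnorm x)).
    by move=> k; rewrite -mulrBl; exact: sqrt_iter_step.
  move=> k; have /andP[_ y1] := sqrt_iter_bound_itv k.
  by rewrite -[leRHS]mul1r ler_wpM2r ?rnorm_ge0.
have cL : contractive L.
  by move=> x; apply: (cvg_norm_bound (YL x)) => k; exact: cY.
have LL : L^† = L.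
  apply: adjoint_eq => x y.
  apply: (norm_cvg_unique (F := (fun k => '[Y k x, y]) @ \oo)); first exact: cvg_innerl.
  rewrite (_ : (fun k => _) = (fun k => '[x, Y k y])); first exact: cvg_innerr.
  by apply/funext => k; rewrite adjointP sqrt_iter_selfadjoint.
have LE x : L x = 2^-1 *: (X x + L (L x)).
  apply: (@seq_cvg_unique _ _ (fun k => Y k x)) => //; rewrite -(cvg_shiftS _).
  apply: cvgZr; apply: cvgD; first exact: cvg_cst.
  (* Both factors of [Y k (Y k x)] vary with [k]; uniform contractivity of [Y k] absorbs the error
     of the inner one. *)
  apply/cvg_rnormP => e e0; have e2 : 0 < e / 2 by rewrite divr_gt0.
  have /cvg_rnormP/(_ _ e2)[N1 P1] := YL x.
  have /cvg_rnormP/(_ _ e2)[N2 P2] := YL (L x).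
  exists (maxn N1 N2) => n; rewrite geq_max => /andP[/P1 n1 /P2 n2].
  rewrite bop_compE -(subrKA (Y n (L x))) [ltRHS]splitr.
  apply: le_lt_trans (rnormD _ _) _; apply: ltrD => //.
  by rewrite -bop_mapN -bop_mapD; apply: le_lt_trans n1; exact: rnorm_contractive.
exists (\Id - L); split.
- move=> x; rewrite !bopE innerDl innerNl subr_ge0 -sqr_norm_inner.
  have Lr : '[L x, x] \is Num.real.
    by rewrite CrealE inner_conj adjointPr LL.
  apply: le_trans (real_ler_norm Lr) _; apply: le_trans (cauchy_schwarz _ _) _.
  by rewrite expr2 ler_wpM2r.
- apply: bopP => x; rewrite !bopE bop_mapD bop_mapN.
  have : L x + L x = X x + L (L x).
    rewrite {1 2}LE -scalerDl (_ : 2^-1 + 2^-1 = 1) ?scale1r//.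
    by rewrite -mulr2n -[_ *+ 2]mulr_natr mulVf ?pnatr_eq0.
  move=> h; have -> : X x = L x + L x - L (L x) by rewrite h addrK.
  by rewrite -addrA -opprD addrA.
- by move=> x; rewrite !bopE opprB addrC subrK; exact: YL.
Qed.

(** [B] commutes with [X = 1 - B^2], hence with [S], a limit of polynomials in [X]. For [D = B - S]
    this gives [(B + S) D = 0]; by positivity both ['[B (D x), D x]] and ['[S (D x), D x]] vanish,
    so [D^3 = 0], and a self-adjoint [D] with this property is 0. *)
Lemma sqrt_unique E (X B S : bop E E) :
  positive_op B -> B ∘ B = \Id - X -> positive_op S -> S ∘ S = \Id - X ->
  (forall x, (fun k => sqrt_iter X k x) @ \oo --> x - S x) -> B = S.
Proof.
move=> pB BB pS SS lS.
have BX : B ∘ X = X ∘ B.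
  have -> : X = \Id - B ∘ B by rewrite BB opprB addrC subrK.
  by rewrite bop_compDr bop_compDl bop_compNr bop_compNl bop_comp1l bop_comp1r bop_compA.
have BS : B ∘ S = S ∘ B.
  apply: bopP => x; rewrite !bop_compE.
  have : B (x - S x) = B x - S (B x).
    apply: (@seq_cvg_unique _ _ (fun k => B (sqrt_iter X k x))); first exact: bop_cvg.
    rewrite (_ : (fun k => _) = (fun k => sqrt_iter X k (B x))) //.
    by apply/funext => k; rewrite -bop_compE (sqrt_iter_intertwine k BX).
  by rewrite bop_mapD bop_mapN => /addrI/oppr_inj.
pose D := B - S.
have DD : D^† = D by rewrite adjointD adjointN !positive_selfadjoint.
have BSD x : B (D x) + S (D x) = 0.
  rewrite -bopDE -bop_compE /D bop_compDl !bop_compDr !bop_compNr -BS BB SS.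
  by rewrite subrKA subrr.
have D0 x : '[D (D x), D x] = 0.
  have := congr1 (fun y => '[y, D x]) (BSD x); rewrite innerDl inner0l => /eqP.
  rewrite paddr_eq0 ?pB ?pS// => /andP[/eqP B0 /eqP S0].
  by rewrite bopDE bopNE innerDl innerNl B0 S0 subrr.
have D3 : D ∘ D ∘ D = 0.
  by apply: quadratic_form_eq0 => x; rewrite !bop_compE adjointP DD.
have sq0 (y : E) : '[y, y] = 0 -> y = 0.
  by rewrite -sqr_norm_inner => /eqP; rewrite sqrf_eq0 normr_eq0 => /eqP.
apply/eqP; rewrite -subr_eq0; apply/eqP/bopP => x; apply: (sq0); rewrite -/D.
rewrite adjointP DD (sq0 (D (D x))) ?inner0r// adjointP DD -!bop_compE D3.
exact: inner0r.
Qed.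

Lemma bop_sqrtP E (X : bop E E) : contractive X -> X^† = X ->
  [/\ positive_op (bop_sqrt (\Id - X)),
      bop_sqrt (\Id - X) ∘ bop_sqrt (\Id - X) = \Id - X &
      forall x, (fun k => sqrt_iter X k x) @ \oo --> x - bop_sqrt (\Id - X) x].
Proof.
move=> cX XX; have [S [pS SS lS]] := sqrt_contractive_exists cX XX.
rewrite /bop_sqrt; case: xgetP => [B _ [pB BB]|/(_ S)]; last by case.
by rewrite (sqrt_unique pB BB pS SS lS).
Qed.

Lemma bop_sqrt_intertwine E F (X : bop E E) (X' : bop F F) (Z : bop E F) :
  contractive X -> X^† = X -> contractive X' -> X'^† = X' -> Z ∘ X = X' ∘ Z ->
  Z ∘ bop_sqrt (\Id - X) = bop_sqrt (\Id - X') ∘ Z.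
Proof.
move=> cX XX cX' XX' ZX; have [_ _ lX] := bop_sqrtP cX XX.
have [_ _ lX'] := bop_sqrtP cX' XX'; apply: bopP => x; rewrite !bop_compE.
have : Z (x - bop_sqrt (\Id - X) x) = Z x - bop_sqrt (\Id - X') (Z x).
  apply: (@seq_cvg_unique _ _ (fun k => Z (sqrt_iter X k x))); first exact: bop_cvg.
  rewrite (_ : (fun k => _) = (fun k => sqrt_iter X' k (Z x))) //.
  by apply/funext => k; rewrite -bop_compE (sqrt_iter_intertwine k ZX).
by rewrite bop_mapD bop_mapN => /addrI/oppr_inj.
Qed.

End SquareRoot.

Section Defects.
Variables (R : realType) (E F : hilbertType R[i]) (W : bop E F).
Hypothesis cW : contractive W.

Let cW' : contractive W^†. Proof. exact: contractive_adjoint. Qed.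

Let WW_contractive : contractive (W^† ∘ W).
Proof. exact: contractive_comp. Qed.

Let WW'_contractive : contractive (W ∘ W^†).
Proof. exact: contractive_comp. Qed.

Let WW_selfadjoint : (W^† ∘ W)^† = W^† ∘ W.
Proof. by rewrite adjoint_comp adjointK. Qed.

Let WW'_selfadjoint : (W ∘ W^†)^† = W ∘ W^†.
Proof. by rewrite adjoint_comp adjointK. Qed.

Lemma defect_sq : defect W ∘ defect W = \Id - W^† ∘ W.
Proof. by have [] := bop_sqrtP WW_contractive WW_selfadjoint. Qed.

Lemma codefect_sq : codefect W ∘ codefect W = \Id - W ∘ W^†.
Proof. by have [] := bop_sqrtP WW'_contractive WW'_selfadjoint. Qed.

Lemma defect_selfadjoint : (defect W)^† = defect W.
Proof.
by apply: positive_selfadjoint; have [] := bop_sqrtP WW_contractive WW_selfadjoint.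
Qed.

Lemma codefect_selfadjoint : (codefect W)^† = codefect W.
Proof.
by apply: positive_selfadjoint; have [] := bop_sqrtP WW'_contractive WW'_selfadjoint.
Qed.

Lemma defect_intertwine : W ∘ defect W = codefect W ∘ W.
Proof. by apply: bop_sqrt_intertwine; rewrite ?bop_compA. Qed.

Lemma defect_intertwine_adjoint : W^† ∘ codefect W = defect W ∘ W^†.
Proof. by apply: bop_sqrt_intertwine; rewrite ?bop_compA. Qed.

End Defects.

(** * Closed ranges and row operators *)

Section ClosedRange.
Variable R : realType.
Local Notation C := R[i].
Implicit Types E F G : hilbertType C.
Local Open Scope classical_set_scope.

Lemma closed_rangeP E F (A : bop E F) y : csubset (closed_range A) y <->
  exists x : nat -> E, (fun k => A (x k)) @ \oo --> y.
Proof.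
split=> [Ay|[x xy]]; last first.
  apply: (@closed_cvg _ _ \oo _ (fun k => A (x k)) _ (csubset_closed _)) xy.
  by apply: filterE => k; apply: subset_closure; exists (x k).
have /choice[x xy] : forall k : nat, exists x, rnorm (y - A x) < k.+1%:R^-1.
  move=> k; have k0 : 0 < k.+1%:R^-1 :> C by rewrite invr_gt0.
  have [_ [[x _ <-] /=]] := Ay _ (nbhsx_ballx y _ k0).
  rewrite -ball_normE /= rnormE => yx; exists x; move: yx.
  by rewrite -[_^-1]/((k.+1%:R)^-1) -[k.+1%:R](rmorph_nat (real_complex R)) -fmorphV ltcR.
exists x; apply/cvg_rnormP => e /inv_nat_small[N NP].
by exists N => n /NP; exact: lt_trans (xy n).
Qed.

Lemma closed_range_map E F E' F' (A : bop E F) (B : bop E' F')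
    (Z : bop F F') (Y : bop E E') : Z ∘ A = B ∘ Y ->
  forall y, csubset (closed_range A) y -> csubset (closed_range B) (Z y).
Proof.
move=> ZA y /closed_rangeP[x xy]; apply/closed_rangeP; exists (fun k => Y (x k)).
rewrite (_ : (fun k => _) = (fun k => Z (A (x k)))); first exact: bop_cvg.
by apply/funext => k; rewrite -!bop_compE ZA.
Qed.

Lemma closed_range_val E F (A : bop E F) x : csubset (closed_range A) (A x).
Proof. by apply: subset_closure; exists x. Qed.

Lemma subspace_mem F (V : closed_subspace F) (x : subspace_type V) : csubset V (val x).
Proof. by have := valP x; rewrite inE. Qed.

Lemma subspace_valP F (V : closed_subspace F) a (x y : subspace_type V) :
  val (a *: x + y) = a *: val x + val y.
Proof. by []. Qed.

Lemma bop_restrictE E F (V : closed_subspace E) (W : closed_subspace F) (A : bop E F) :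
  (forall x, csubset V x -> csubset W (A x)) ->
  forall x, val (bop_restrict V W A x) = A (val x).
Proof.
move=> AVW.
have AW (x : subspace_type V) : A (val x) \in csubset_pred W.
  by apply: mem_set; apply: AVW; exact: subspace_mem.
pose B (x : subspace_type V) : subspace_type W := Sub (A (val x)) (AW x).
have Bl : linear B.
  move=> a x y; apply: val_inj.
  by rewrite subspace_valP -[LHS]/(A (val _)) subspace_valP linearP.
have Bb : exists M : C, forall x, `|B x| <= M * `|x|.
  have [M AM] := bop_bounded A; exists M => x; rewrite !subspace_norm; exact: AM.
have BA : [set B : bop (subspace_type V) (subspace_type W) |
          forall x, val (B x) = A (val x)] (Bop Bl Bb) by move=> x.
rewrite /bop_restrict; case: xgetP => [D _ //|/(_ _ BA)//].
Qed.

Lemma bop_restrict_adjoint E F (V : closed_subspace E) (W : closed_subspace F)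
    (A : bop E F) :
  (forall x, csubset V x -> csubset W (A x)) ->
  (forall y, csubset W y -> csubset V (A^† y)) ->
  (bop_restrict V W A)^† = bop_restrict W V A^†.
Proof.
move=> AVW AWV; apply: adjoint_eq => x y.
rewrite -[LHS]/('[val _, val _]) -[RHS]/('[val _, val _]).
by rewrite !bop_restrictE// adjointP.
Qed.

(** The closure of the relation [A x |-> B x]. When [A] and [B] have equal norms on every vector it
    is the graph of an isometry, although neither operator need be injective. *)
Definition range_graph E F G (A : bop E F) (B : bop E G) (p : F) (q : G) :=
  exists x : nat -> E, (fun k => A (x k)) @ \oo --> p /\ (fun k => B (x k)) @ \oo --> q.

Section RangeUnitary.
Variables (E F G : hilbertType C) (A : bop E F) (B : bop E G).
Hypothesis AB : forall x, `|A x| = `|B x|.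

Lemma range_graph_norm p q : range_graph A B p q -> `|p| = `|q|.
Proof.
move=> [x [/cvg_rnormP Ax /cvg_rnormP Bx]]; rewrite !rnormE; congr (_%:C)%C.
suff h e : 0 < e -> rnorm p <= rnorm q + e /\ rnorm q <= rnorm p + e.
  by apply/le_anti/andP; split; apply/ler_addgt0Pr => e /h[].
move=> e0; have e2 : 0 < e / 2 by rewrite divr_gt0.
have [N1 P1] := Ax _ e2; have [N2 P2] := Bx _ e2; pose k := maxn N1 N2.
have {P1}P1 := P1 k (leq_maxl _ _); have {P2}P2 := P2 k (leq_maxr _ _).
have AB' : rnorm (A (x k)) = rnorm (B (x k)) by rewrite /rnorm AB.
have := rnormD (p - A (x k)) (A (x k)); have := rnormD (A (x k) - p) p.
have := rnormD (q - B (x k)) (B (x k)); have := rnormD (B (x k) - q) q.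
rewrite !subrK (rnormB _ p) (rnormB _ q) AB'.
by move: (rnorm _) (rnorm _) (rnorm _) (rnorm _) (rnorm _) P1 P2 => *; split; lra.
Qed.

Lemma range_graphP a p q p' q' : range_graph A B p q -> range_graph A B p' q' ->
  range_graph A B (a *: p + p') (a *: q + q').
Proof.
move=> [x [Ax Bx]] [x' [Ax' Bx']]; exists (fun k => a *: x k + x' k).
by split; under eq_fun => k do rewrite linearP; apply: cvgD => //; apply: cvgZr.
Qed.

Lemma range_graph_unique p q q' :
  range_graph A B p q -> range_graph A B p q' -> q = q'.
Proof.
move=> pq /(range_graphP (-1) pq); rewrite !scaleN1r addNr => /range_graph_norm.
by rewrite normr0 => /esym/eqP; rewrite normr_eq0 addrC subr_eq0 => /eqP.
Qed.

Lemma range_graph_exists p : csubset (closed_range A) p ->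
  exists2 q, csubset (closed_range B) q & range_graph A B p q.
Proof.
move=> /closed_rangeP[x xp].
have [|q xq] := @seq_complete R G (fun k => B (x k)).
  move=> e e0; have e2 : 0 < e / 2 by rewrite divr_gt0.
  have /cvg_rnormP/(_ _ e2)[N NP] := xp; exists N => m n Nm Nn.
  have -> : rnorm (B (x m) - B (x n)) = rnorm (A (x m) - A (x n)).
    by rewrite -!bop_mapN -!bop_mapD /rnorm AB.
  rewrite -(subrKA p) [ltRHS]splitr; apply: le_lt_trans (rnormD _ _) _.
  by rewrite rnormB ltrD ?NP.
move/cvg_rnormP in xq; exists q; last by exists x.
by apply/closed_rangeP; exists x.
Qed.

Lemma range_isometry_exists :
  exists U : bop (subspace_type (closed_range A)) (subspace_type (closed_range B)),
    forall p, range_graph A B (val p) (val (U p)).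
Proof.
have /choice[U UP] : forall p : subspace_type (closed_range A),
    exists q : subspace_type (closed_range B), range_graph A B (val p) (val q).
  move=> p; have [q Bq pq] := range_graph_exists (subspace_mem p).
  by exists (Sub q (mem_set Bq)).
have Ul : linear U.
  move=> a p p'; apply: val_inj; rewrite subspace_valP.
  apply: (range_graph_unique (UP _)); rewrite subspace_valP.
  exact: range_graphP.
have Ub : exists M : C, forall p, `|U p| <= M * `|p|.
  by exists 1 => p; rewrite mul1r !subspace_norm (range_graph_norm (UP p)).
by exists (Bop Ul Ub).
Qed.

End RangeUnitary.

(** The construction is symmetric in [A] and [B], which provides a right inverse [V] of [U]. Norm
    preservation and polarization give [U^† ∘ U = \Id], whence [U^† = V]. *)
Lemma range_unitary E F G (A : bop E F) (B : bop E G) : (forall x, `|A x| = `|B x|) ->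
  exists2 U : bop (subspace_type (closed_range A)) (subspace_type (closed_range B)),
    unitary_op U & forall p x, val p = A x -> val (U p) = B x.
Proof.
move=> AB; have [U UP] := range_isometry_exists AB.
have [V VP] := range_isometry_exists (fun x => esym (AB x)).
have UV q : U (V q) = q.
  apply: val_inj; apply: (range_graph_unique AB (UP _)).
  by have [x [Bx Ax]] := VP q; exists x.
have UU : U^† ∘ U = \Id.
  apply/eqP; rewrite -subr_eq0; apply/eqP/quadratic_form_eq0 => p.
  rewrite bopDE bopNE innerDl innerNl bop_compE -adjointPr -!sqr_norm_inner.
  by rewrite !subspace_norm (range_graph_norm AB (UP p)) subrr.
have UVid : U ∘ V = \Id by apply: bopP.
exists U.
  split=> //; have -> : U^† = V by rewrite -[LHS]bop_comp1r -UVid bop_compA UU bop_comp1l.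
  exact: UVid.
move=> p x px; apply: (range_graph_unique AB (UP p)); rewrite px.
by exists (fun=> x); split; exact: cvg_cst.
Qed.

End ClosedRange.

(** * Row operators and unitary changes of coordinates *)

Section Rows.
Variables (R : realType) (H : hilbertType R[i]) (n : nat).
Local Notation C := R[i].
Implicit Types (T S : 'I_n -> bop H H) (z w : 'cV[C]_n).

Lemma row_op_adjointE T y i : (row_op T)^† y i = (T i)^† y.
Proof.
apply: inner_extr => x; rewrite -adjointP -(row_opK T i) bop_compE adjointP.
rewrite -[RHS]/(hpow_inner _ _) /hpow_inner (bigD1 i)//= big1 ?addr0 => [|j /negPf ji].
  by rewrite ffunE eqxx.
by rewrite ffunE ji inner0l.
Qed.

Lemma row_op_comp_adjoint T S : row_op T ∘ (row_op S)^† = \sum_i T i ∘ (S i)^†.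
Proof.
apply: bopP => x; rewrite bop_compE row_opE bop_sumE.
by apply: eq_bigr => i _; rewrite row_op_adjointE.
Qed.

Lemma row_op_row_entry (W : bop (hpow H n) H) : row_op (row_entry W) = W.
Proof.
apply: bopP => x; rewrite row_opE [in RHS](_ : x = \sum_i hpow_inj H i (x i)).
  by rewrite linear_sum.
apply/ffunP => j; rewrite sum_ffunE (bigD1 j)//= big1 => [|i /negPf ij].
  by rewrite ffunE eqxx addr0.
by rewrite ffunE eq_sym ij.
Qed.

Lemma scalar_row_comp_adjoint z w :
  scalar_row H z ∘ (scalar_row H w)^† = cdot z w *: \Id.
Proof.
rewrite row_op_comp_adjoint /cdot scaler_suml; apply: eq_bigr => i _.
by rewrite adjointZ adjoint_id bop_compZl bop_comp1l scalerA.
Qed.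

Lemma scalar_row_comp_row_adjoint z T :
  scalar_row H z ∘ (row_op T)^† = \sum_i z i 0 *: (T i)^†.
Proof.
by rewrite row_op_comp_adjoint; apply: eq_bigr => i _; rewrite bop_compZl bop_comp1l.
Qed.

Lemma scalar_rowP a z w : scalar_row H (a *: z + w) = a *: scalar_row H z + scalar_row H w.
Proof.
apply: bopP => h; rewrite bopDE bopZE !row_opE scaler_sumr -big_split.
by apply: eq_bigr => i _; rewrite !bopZE !mxE scalerDl scalerA.
Qed.

Lemma scalar_rowZ a z : scalar_row H (a *: z) = a *: scalar_row H z.
Proof.
apply: bopP => h; rewrite bopZE !row_opE scaler_sumr.
by apply: eq_bigr => i _; rewrite !bopZE !mxE scalerA.
Qed.

Lemma scalar_rowB z w : scalar_row H (z - w) = scalar_row H z - scalar_row H w.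
Proof. by rewrite addrC -scaleN1r scalar_rowP scaleN1r addrC. Qed.

Section Unitary.
Variables (u : 'M[C]_n) (T : 'I_n -> bop H H).

Lemma unitary_tuple_scalar_row z :
  scalar_row H z ∘ (row_op (unitary_tuple u T))^† =
  scalar_row H (u^t* *m z) ∘ (row_op T)^†.
Proof.
rewrite !scalar_row_comp_row_adjoint.
under eq_bigr => i _ do rewrite adjoint_sum scaler_sumr.
rewrite exchange_big; apply: eq_bigr => j _; rewrite mxE scaler_suml.
by apply: eq_bigr => i _; rewrite adjointZ scalerA !mxE mulrC.
Qed.

Lemma unitary_tuple_gram : u \is unitarymx ->
  row_op (unitary_tuple u T) ∘ (row_op (unitary_tuple u T))^† =
  row_op T ∘ (row_op T)^†.
Proof.
(* [unitarymx] asserts [u *m u^t* = 1], while the sum over [i] needs orthonormal columns, hence the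
   product in the other order. *)
move=> /unitarymxP uu; have {}uu : u^t* *m u = 1%:M by apply: mulmx1C.
rewrite !row_op_comp_adjoint /unitary_tuple.
transitivity (\sum_j \sum_k (\sum_i (u i k)^* * u i j) *: (T j ∘ (T k)^†)).
  under eq_bigr => i _.
    rewrite (_ : _ ∘ _ = \sum_j \sum_k ((u i k)^* * u i j) *: (T j ∘ (T k)^†)); last first.
      apply: bopP => x; rewrite bop_compE bop_sumE bop_sumE; apply: eq_bigr => j _.
      rewrite adjoint_sum bopZE bop_sumE linear_sum scaler_sumr bop_sumE.
      apply: eq_bigr => k _; rewrite adjointZ !bopZE linearZ_LR scalerA mulrC.
      by [].
    over.
  rewrite exchange_big; apply: eq_bigr => j _; rewrite exchange_big.
  by apply: eq_bigr => k _; rewrite scaler_suml.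
apply: eq_bigr => j _; rewrite (bigD1 j)//= [X in _ + X]big1 => [|k kj].
  have := congr1 (fun M : 'M_n => M j j) uu; rewrite !mxE eqxx => ujj.
  rewrite addr0 -[RHS]scale1r -[1 in RHS]ujj; congr (_ *: _).
  by apply: eq_bigr => i _; rewrite !mxE.
have := congr1 (fun M : 'M_n => M k j) uu; rewrite !mxE (negPf kj) => ukj.
rewrite -[RHS](scale0r (T j ∘ (T k)^†)) -[0 in RHS]ukj; congr (_ *: _).
by apply: eq_bigr => i _; rewrite !mxE.
Qed.

End Unitary.

End Rows.

(** * Characteristic functions *)

Section BallScalars.
Variables (R : realType) (n : nat).
Local Notation C := R[i].
Implicit Types a z w x y : 'cV[C]_n.

Lemma cdotE z w : cdot z w = (w^t* *m z) 0 0.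
Proof. by rewrite mxE; apply: eq_bigr => i _; rewrite !mxE mulrC. Qed.

Lemma cdotDl x y z : cdot (x + y) z = cdot x z + cdot y z.
Proof. by rewrite -big_split; apply: eq_bigr => i _; rewrite !mxE mulrDl. Qed.

Lemma cdotZl c x z : cdot (c *: x) z = c * cdot x z.
Proof. by rewrite /cdot mulr_sumr; apply: eq_bigr => i _; rewrite !mxE mulrA. Qed.

Lemma cdot_conj x y : (cdot x y)^* = cdot y x.
Proof.
rewrite rmorph_sum; apply: eq_bigr => i _.
by rewrite rmorphM/= conjCK mulrC.
Qed.

Lemma cdotDr x y z : cdot z (x + y) = cdot z x + cdot z y.
Proof. by rewrite -cdot_conj cdotDl rmorphD/= !cdot_conj. Qed.

Lemma cdotZr c x z : cdot z (c *: x) = c^* * cdot z x.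
Proof. by rewrite -cdot_conj cdotZl rmorphM/= cdot_conj. Qed.

Lemma cdot_ge0 x : 0 <= cdot x x.
Proof. by apply: sumr_ge0 => i _; rewrite -normCK exprn_ge0. Qed.

Lemma unitary_cdot (u : 'M[C]_n) z w : u \is unitarymx ->
  cdot (u^t* *m z) (u^t* *m w) = cdot z w.
Proof.
move=> /unitarymxP uu; rewrite !cdotE.
have -> : (u^t* *m w)^t* = w^t* *m u.
  apply/matrixP => i j; rewrite !mxE rmorph_sum; apply: eq_bigr => k _.
  by rewrite !mxE rmorphM/= conjCK mulrC.
by rewrite -mulmxA [u *m _]mulmxA uu mul1mx.
Qed.

(** If [cdot z a] were 1, then [|z - a|^2 = |z|^2 + |a|^2 - 2] would be negative. *)
Lemma cdot_neq1 z a : unit_ball z -> unit_ball a -> 1 - cdot z a != 0.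
Proof.
rewrite /unit_ball /= => z1 a1; rewrite subr_eq0 eq_sym; apply/negP => /eqP za.
have az : cdot a z = 1 by rewrite -cdot_conj za rmorph1.
have := cdot_ge0 (-1 *: a + z); rewrite cdotDl !cdotDr !cdotZl !cdotZr za az rmorphN rmorph1.
have -> : -1 * (-1 * cdot a a) + -1 * 1 + (-1 * 1 + cdot z z) = cdot a a - 1 + (cdot z z - 1).
  by ring.
by apply/negP; rewrite -real_ltNge ?rpred0 ?rpredD ?rpredN ?rpred1 ?ger0_real ?cdot_ge0//
  -[ltRHS]addr0 ltrD ?subr_lt0.
Qed.

Lemma ball_s_sqr a : unit_ball a -> ball_s a ^+ 2 = 1 - cdot a a.
Proof. by rewrite sqrtCK. Qed.

Lemma ball_s_gt0 a : unit_ball a -> 0 < ball_s a.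
Proof. by move=> a1; rewrite sqrtC_gt0 subr_gt0. Qed.

(** By [autE] the automorphism sends [x] to a combination of [a] and [x] with scalar coefficients,
    so everything becomes a rational identity in the inner products of [a], [w], [z] and in [s]. *)
Lemma ball_aut_cdot a z w : unit_ball a -> unit_ball z -> unit_ball w ->
  1 - cdot (ball_aut a w) (ball_aut a z) =
  ball_s a ^+ 2 / ((1 - cdot w a) * (1 - cdot a z)) * (1 - cdot w z).
Proof.
move=> a1 z1 w1; set s := ball_s a.
have sr : s^* = s by rewrite geC0_conj// ltW ?ball_s_gt0.
have wa := cdot_neq1 w1 a1; have az := cdot_neq1 a1 z1.
have aE : cdot a a = 1 - s ^+ 2 by rewrite ball_s_sqr// subKr.
pose k x := 1 - (1 - s) * (cdot x a / cdot a a).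
have autE x : ball_aut a x = (1 - cdot x a)^-1 *: (k x *: a + (- s) *: x).
  rewrite /ball_aut /line_proj -/s; congr (_ *: _); apply/colP => i; rewrite !mxE /k.
  by ring.
rewrite !autE !(cdotZl, cdotZr) !cdotDl !cdotDr !(cdotZl, cdotZr).
rewrite fmorphV rmorphB rmorph1 /= !cdot_conj rmorphN /= sr.
rewrite {1}/k /k rmorphB rmorphM rmorphB rmorph1 /= sr fmorph_div /= !cdot_conj.
(* [field] needs [cdot a a] invertible. For [a = 0] the convention [0^-1 = 0] removes the projection
   and leaves [x |-> - s x] with [s^2 = 1]. *)
have [a0|a0] := eqVneq (cdot a a) 0.
  have a00 : a = 0 by apply/eqP; rewrite -cdot_eq0 a0.
  have s2 : s ^+ 2 = 1 by move: aE; rewrite a0 => /esym/eqP; rewrite subr_eq0 => /eqP.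
  rewrite a00 s2 !(mul0r, mulr0, subr0, invr1, mulr1, mul1r, add0r, addr0).
  have c0 x : cdot 0 x = 0 :> C by apply: big1 => i _; rewrite mxE mul0r.
  have c0r x : cdot x 0 = 0 :> C by rewrite -cdot_conj c0 rmorph0.
  rewrite !(c0, c0r, mulr0, mul0r, subr0, invr1, mul1r, mulr1, add0r, addr0).
  by rewrite mulrA mulrNN -expr2 s2 mul1r.
by rewrite aE in a0 *; field; apply/and3P; split.
Qed.

Lemma ball_aut_ball a z : unit_ball a -> unit_ball z -> unit_ball (ball_aut a z).
Proof.
move=> a1 z1; rewrite /unit_ball /= -subr_gt0 ball_aut_cdot//.
rewrite mulr_gt0 ?subr_gt0// divr_gt0 ?exprn_gt0 ?ball_s_gt0//.
rewrite -[X in _ * X]conjCK rmorphB rmorph1 /= cdot_conj -normCK exprn_gt0// normr_gt0.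
exact: cdot_neq1.
Qed.

End BallScalars.

(** * The kernel of the characteristic function *)

Section Characteristic.
Variables (R : realType) (H : hilbertType R[i]) (n : nat) (T : 'I_n -> bop H H).
Local Notation C := R[i].
Local Notation W := (row_op T).
Hypothesis cW : contractive W.
Implicit Types (z w : 'cV[C]_n).

Definition resolvent z := bop_inv (\Id - scalar_row H z ∘ W^†).

(** The values of [char_fun] before restriction to the defect spaces; working on all of [H] keeps
    subspace types out of the kernel computation. *)
Definition char_op z : bop (hpow H n) H :=
  - W + codefect W ∘ resolvent z ∘ scalar_row H z ∘ defect W.

Lemma scalar_row_bound z (h : hpow H n) : `|scalar_row H z h| <= sqrtC (cdot z z) * `|h|.
Proof.
rewrite -(adjointK (scalar_row H z)); apply: adjoint_bound.
  by rewrite sqrtC_ge0 cdot_ge0.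
move=> x; rewrite -(ler_pXn2r (n := 2%N)) ?nnegrE ?mulr_ge0 ?sqrtC_ge0 ?cdot_ge0//.
rewrite exprMn sqrtCK !sqr_norm_inner -adjointPr -bop_compE.
by rewrite scalar_row_comp_adjoint bopZE innerZr bop_idE cdot_conj sqrtCK.
Qed.

(** Since [Z Z^† = |z|^2] and [W^†] is a contraction, [Z W^†] has norm at most [|z| < 1]. *)
Lemma resolventP z : unit_ball z ->
  (\Id - scalar_row H z ∘ W^†) ∘ resolvent z = \Id /\
  resolvent z ∘ (\Id - scalar_row H z ∘ W^†) = \Id.
Proof.
rewrite /unit_ball /= => z1; apply: (@neumann _ _ _ (complex.Re (sqrtC (cdot z z)))).
  have s0 : 0 <= sqrtC (cdot z z) by rewrite sqrtC_ge0 cdot_ge0.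
  rewrite Re_ge0//= -ltcR -ge0_Re_eq// -[_%:C%C]/(1 : C).
  by rewrite -(ltr_pXn2r (n := 2%N)) ?nnegrE// sqrtCK expr1n.
move=> x; rewrite -lecR rmorphM/= -!rnormE -ge0_Re_eq ?sqrtC_ge0 ?cdot_ge0//.
apply: le_trans (scalar_row_bound _ _) _; apply: ler_wpM2l.
  by rewrite sqrtC_ge0 cdot_ge0.
exact: contractive_adjoint.
Qed.

Lemma resolvent_adjointE z x : unit_ball z ->
  W ((scalar_row H z)^† ((resolvent z)^† x)) = (resolvent z)^† x - x.
Proof.
move=> /resolventP[_ /(congr1 (fun A => A^†))]; rewrite adjoint_comp adjoint_id.
rewrite adjointD adjointN adjoint_id adjoint_comp adjointK.
move=> /(congr1 (fun A : bop H H => A x)); rewrite !bopE => {3}<-.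
by rewrite opprB addrC subrK.
Qed.

Lemma char_op_adjointE z x : (char_op z)^† x =
  - (W^† x) + defect W ((scalar_row H z)^† ((resolvent z)^† (codefect W x))).
Proof.
rewrite /char_op adjointD adjointN !adjoint_comp.
by rewrite defect_selfadjoint// codefect_selfadjoint.
Qed.

(** Let [p], [q] be the two resolvent vectors on the right. The cross terms reduce by [W D_T = D W]
    and [W Z^† p = p - D x], the quadratic one by [D_T^2 = 1 - W^† W]; all that survives besides
    ['[x, y]] is ['[Zp, Zq] - '[p, q]]. *)
Lemma char_op_kernel z w x y : unit_ball z -> unit_ball w ->
  '[(char_op z)^† x, (char_op w)^† y] =
  '[x, y] - (1 - cdot w z) *
    '[(resolvent z)^† (codefect W x), (resolvent w)^† (codefect W y)].
Proof.
move=> z1 w1; rewrite !char_op_adjointE.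
have := resolvent_adjointE (codefect W x) z1; have := resolvent_adjointE (codefect W y) w1.
move: ((resolvent z)^† _) ((resolvent w)^† _) => p q Wq Wp.
set D := codefect W in Wp Wq *; set Dt := defect W; set Zp := (scalar_row H z)^† p in Wp *.
set Zq := (scalar_row H w)^† q in Wq *.
have ZZ : '[Zp, Zq] = cdot w z * '[p, q].
  by rewrite /Zq -adjointP -bop_compE scalar_row_comp_adjoint bopZE innerZl.
have Dsa : D^† = D by exact: codefect_selfadjoint.
have Dtsa : Dt^† = Dt by exact: defect_selfadjoint.
have WDt v : W (Dt v) = D (W v) by rewrite -!bop_compE defect_intertwine.
have DD u v : '[D u, D v] = '[u, v] - '[W^† u, W^† v].
  by rewrite adjointP Dsa -bop_compE codefect_sq// bopDE bopNE innerDr innerNr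
    bop_idE bop_compE adjointPr.
have DtDt : '[Dt Zp, Dt Zq] = '[Zp, Zq] - '[W Zp, W Zq].
  by rewrite adjointP Dtsa -bop_compE defect_sq// bopDE bopNE innerDr innerNr
    bop_idE bop_compE -adjointP.
have e1 : '[W^† x, Dt Zq] = '[D x, q - D y].
  by rewrite -adjointPr WDt Wq adjointPr Dsa.
have e2 : '[Dt Zp, W^† y] = '[p - D x, D y].
  by rewrite -adjointP WDt Wp adjointP Dsa.
have e3 : '[W^† x, W^† y] = '[x, y] - '[D x, D y] by rewrite DD opprB addrC subrK.
rewrite innerDl !innerDr !innerNl !innerNr e1 e2 e3 DtDt Wp Wq ZZ !innerE.
by ring.
Qed.

Lemma char_op_adjoint_contractive z x : unit_ball z -> `|(char_op z)^† x| <= `|x|.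
Proof.
move=> z1; rewrite norm_le_inner char_op_kernel// gerBl mulr_ge0 ?dnorm_ge0//.
by rewrite subr_ge0 ltW.
Qed.

(** Precomposed with [D_T], the operator has [D] as a left factor, since [W D_T = D W]; the witness
    [Y] is the other factor. *)
Lemma char_op_closed_range z x : csubset (closed_range (defect W)) x ->
  csubset (closed_range (codefect W)) (char_op z x).
Proof.
apply: (closed_range_map (Y := - W + resolvent z ∘ scalar_row H z ∘ defect W ∘ defect W)).
by rewrite /char_op bop_compDl bop_compDr bop_compNl bop_compNr defect_intertwine// !bop_compA.
Qed.

Lemma char_op_adjoint_closed_range z x : csubset (closed_range (codefect W)) x ->
  csubset (closed_range (defect W)) ((char_op z)^† x).
Proof.
apply: (closed_range_map (Y := - W^† +
  (scalar_row H z)^† ∘ (resolvent z)^† ∘ codefect W ∘ codefect W)).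
rewrite /char_op adjointD adjointN !adjoint_comp defect_selfadjoint// codefect_selfadjoint//.
by rewrite bop_compDl bop_compDr bop_compNl bop_compNr defect_intertwine_adjoint// !bop_compA.
Qed.

(** Restriction commutes with the adjoint because [char_op z] and its adjoint both respect the two
    defect spaces. *)
Lemma char_fun_adjoint_val z p : val ((char_fun T z)^† p) = (char_op z)^† (val p).
Proof.
rewrite [(char_fun T z)^†](bop_restrict_adjoint (A := char_op z)).
- by rewrite bop_restrictE//; exact: char_op_adjoint_closed_range.
- exact: char_op_closed_range.
- exact: char_op_adjoint_closed_range.
Qed.

Lemma char_fun_contractive z : unit_ball z -> contractive (char_fun T z).
Proof.
move=> z1; rewrite -[X in contractive X]adjointK; apply: contractive_adjoint => p.
by rewrite !subspace_norm char_fun_adjoint_val; exact: char_op_adjoint_contractive.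
Qed.

End Characteristic.

(** * The action of ball automorphisms *)

Section Transform.
Variables (R : realType) (H : hilbertType R[i]) (n : nat) (T : 'I_n -> bop H H).
Local Notation C := R[i].
Local Notation W := (row_op T).
Hypothesis cW : contractive W.
Variable a : 'cV[C]_n.
Hypothesis a1 : unit_ball a.
Implicit Types (z w : 'cV[C]_n) (x y : H) (v : hpow H n).
Local Notation A := (scalar_row H a).
Local Notation s := (ball_s a).
Local Notation Ra := (resolvent T a).
Local Notation Wa := (ball_aut_row a T).

(** As [A A^† = |a|^2], this is the orthogonal projection of [hpow H n] onto the range of [A^†], and
    0 when [a = 0]. *)
Let P v := (cdot a a)^-1 *: A^† (A v).

Let s_conj : s^* = s.
Proof. by rewrite geC0_conj// ltW ?ball_s_gt0. Qed.

Let cdotaa_conj : (cdot a a)^* = cdot a a.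
Proof. exact: cdot_conj. Qed.

Let resolvent_aE x : x = Ra x - A (W^† (Ra x)).
Proof.
have [/(congr1 (fun B : bop H H => B x)) RE _] := resolventP cW a1.
by rewrite -[LHS]RE.
Qed.

(** The inverse in [ball_aut_row] is [Ra^†], so [Wa^†] factors through [Ra]. With [x = y - A v] for
    [y = Ra x] and [v = W^† y], the identities below become computations in [y] and [v]. *)
Lemma ball_aut_row_adjointE x : Wa^† x =
  A^† (Ra x) - P (W^† (Ra x)) - s *: (W^† (Ra x) - P (W^† (Ra x))).
Proof.
have invE : bop_inv (\Id - W ∘ A^†) = Ra^†.
  have [/(congr1 (fun B => B^†)) R1 /(congr1 (fun B => B^†)) R2] := resolventP cW a1.
  move: R1 R2; rewrite !adjoint_comp adjointD adjointN adjoint_id adjoint_comp adjointK.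
  by move=> R1 R2; apply: bop_inv_eq.
rewrite /ball_aut_row invE adjoint_comp adjointK /row_line_proj.
rewrite !(adjointD, adjointN, adjointZ) !adjoint_comp adjointK s_conj fmorphV /= cdotaa_conj.
by [].
Qed.

Let A0 v : a = 0 -> A v = 0.
Proof. by move=> ->; rewrite -(scale0r (0 : 'cV[C]_n)) scalar_rowZ bopZE scale0r. Qed.

Let AP v : A (P v) = A v.
Proof.
rewrite /P bop_mapZ -bop_compE scalar_row_comp_adjoint bopZE scalerA bop_idE.
have [a0|a0] := eqVneq a 0; last by rewrite mulVf ?scale1r// cdot_eq0.
by rewrite A0 ?scaler0.
Qed.

(** The cross terms of [y] and [v] agree on both sides of the subtraction because [A P = A]. The
    rest follows from [|A^† y|^2 = |a|^2 |y|^2], [|A v|^2 = |a|^2 |P v|^2] and [s^2 = 1 - |a|^2]. *)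
Lemma ball_aut_gram x : '[x, x] - '[Wa^† x, Wa^† x] =
  s ^+ 2 * ('[Ra x, Ra x] - '[W^† (Ra x), W^† (Ra x)]).
Proof.
rewrite ball_aut_row_adjointE {1 2}(resolvent_aE x).
move: (Ra x) => y; move: (W^† y) => v.
have AAy : '[A^† y, A^† y] = cdot a a * '[y, y].
  by rewrite -adjointP -bop_compE scalar_row_comp_adjoint bopZE innerZl.
have Ayl (t : hpow H n) : '[A^† y, t] = '[y, A t] by rewrite adjointPr.
have Ayr (t : hpow H n) : '[t, A^† y] = '[A t, y] by rewrite adjointP.
pose k := '[P v, v]; have kr : '[v, P v] = k.
  rewrite /k /P innerZl innerZr fmorphV /= cdotaa_conj.
  by rewrite -[in RHS]adjointPr -[in LHS]adjointP.
have PP : '[P v, P v] = k.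
  by rewrite /k [in LHS]/P innerZl -adjointPr AP /P innerZl -adjointPr.
have q : '[A v, A v] = (1 - s ^+ 2) * k.
  rewrite ball_s_sqr// subKr /k /P innerZl -adjointPr.
  have [a0|a0] := eqVneq a 0; first by rewrite A0// inner0l !mulr0.
  by rewrite mulrA mulfV ?mul1r// cdot_eq0.
have AAy' : '[A^† y, A^† y] = (1 - s ^+ 2) * '[y, y] by rewrite AAy ball_s_sqr// subKr.
have Pv : '[P v, v] = k by [].
move: (P v) (AP v) PP kr Pv => p Ap PP kr Pv.
by rewrite !innerE AAy' !Ayl !Ayr !Ap PP kr Pv q s_conj; ring.
Qed.

(** Because [Z A^† = cdot z a], applying [Z] to [Wa^† x] and adding [A v] produces the row of the
    numerator of [ball_aut a z] at [v]. *)
Lemma ball_aut_shift z : unit_ball z -> \Id - scalar_row H z ∘ Wa^† =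
  (1 - cdot z a) *: ((\Id - scalar_row H (ball_aut a z) ∘ W^†) ∘ Ra).
Proof.
move=> z1; have za := cdot_neq1 z1 a1.
apply: bopP => x; rewrite bopDE bopNE bopZE !bop_compE ball_aut_row_adjointE.
rewrite bop_idE [X in X - _](resolvent_aE x) bopDE bopNE bop_idE !bop_compE.
move: (Ra x) => y; move: (W^† y) => v.
rewrite /ball_aut scalar_rowZ !(scalar_rowB, scalar_rowZ).
rewrite !(bop_mapD, bop_mapN, bop_mapZ) /P.
have ZA (t : H) : scalar_row H z (A^† t) = cdot z a *: t.
  by rewrite -bop_compE scalar_row_comp_adjoint.
rewrite !ZA; apply: inner_ext => t.
rewrite !(bopDE, bopNE, bopZE) !innerE.
(* The identity holds for any value of [r], so [a = 0] needs no separate case. *)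
by move: (cdot a a)^-1 => r; field.
Qed.

(** In the inverse of the factorization above, the leftmost factor is the inverse of [Ra], which the
    [Ra] in front cancels. *)
Lemma ball_aut_resolvent z B : unit_ball z -> scalar_row H z ∘ B = scalar_row H z ∘ Wa^† ->
  Ra ∘ bop_inv (\Id - scalar_row H z ∘ B) =
  (1 - cdot z a)^-1 *: resolvent T (ball_aut a z).
Proof.
move=> z1 ->; have za := cdot_neq1 z1 a1.
have [Ra1 Ra2] := resolventP cW a1.
have [Rz1 Rz2] := resolventP cW (ball_aut_ball a1 z1).
rewrite ball_aut_shift// (@bop_inv_eq _ _ _
  ((1 - cdot z a)^-1 *: ((\Id - A ∘ W^†) ∘ resolvent T (ball_aut a z)))).
- by rewrite bop_compZr bop_compA Ra2 bop_comp1l.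
- rewrite bop_compZl bop_compZr scalerA mulfV// scale1r.
  by rewrite -bop_compA [Ra ∘ _]bop_compA Ra2 bop_comp1l Rz1.
- rewrite bop_compZl bop_compZr scalerA mulVf// scale1r.
  by rewrite -bop_compA [_ ∘ (_ ∘ Ra)]bop_compA Rz2 bop_comp1l Ra1.
Qed.

Variable u : 'M[C]_n.
Hypothesis uu : u \is unitarymx.
Local Notation T' := (unitary_tuple u (ball_aut_tuple a T)).
Local Notation W' := (row_op T').

Let row_T : row_op (ball_aut_tuple a T) = Wa.
Proof. exact: row_op_row_entry. Qed.

Lemma transform_gram x : '[x, x] - '[W'^† x, W'^† x] =
  s ^+ 2 * ('[Ra x, Ra x] - '[W^† (Ra x), W^† (Ra x)]).
Proof.
rewrite -ball_aut_gram; congr (_ - _).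
by rewrite -!adjointPr -!bop_compE unitary_tuple_gram// row_T.
Qed.

Lemma transform_contractive : contractive W'.
Proof.
rewrite -[X in contractive X]adjointK; apply: contractive_adjoint => x.
rewrite norm_le_inner -subr_ge0 transform_gram mulr_ge0//.
  by rewrite exprn_ge0// ltW ?ball_s_gt0.
by rewrite subr_ge0 -norm_le_inner; exact: contractive_adjoint.
Qed.

Lemma transform_resolvent z x : unit_ball z ->
  (resolvent T' z)^† (Ra^† x) =
  (1 - cdot a (u^t* *m z))^-1 *: (resolvent T (ball_aut a (u^t* *m z)))^† x.
Proof.
move=> z1; have uz1 : unit_ball (u^t* *m z) by rewrite /unit_ball /= unitary_cdot.
have E : scalar_row H z ∘ W'^† = scalar_row H (u^t* *m z) ∘ Wa^†.
  by rewrite unitary_tuple_scalar_row row_T.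
rewrite -bop_compE -adjoint_comp /resolvent E ball_aut_resolvent//.
by rewrite adjointZ bopZE fmorphV rmorphB rmorph1 /= cdot_conj.
Qed.

Lemma codefect_norm (x : H) : `|codefect W x| ^+ 2 = '[x, x] - '[W^† x, W^† x].
Proof.
rewrite sqr_norm_inner adjointP codefect_selfadjoint// -bop_compE codefect_sq//.
by rewrite bopDE bopNE innerDr innerNr bop_idE bop_compE adjointPr.
Qed.

End Transform.

(** * The unitary between the defect spaces and weak coincidence *)

Lemma norm_eq_sqr (C : numClosedFieldType) (E F : hilbertType C) (x : E) (y : F) :
  `|x| ^+ 2 = `|y| ^+ 2 -> `|x| = `|y|.
Proof.
by move=> xy; apply/eqP; rewrite -(@eqrXn2 _ 2%N) ?normr_ge0//; apply/eqP.
Qed.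

(** Equality of the records, not just of the sets, is needed to change the domain type of [tau]. *)
Lemma closed_range_eq (R : realType) (E E' F : hilbertType R[i]) (A : bop E F)
    (B : bop E' F) : range A = range B -> closed_range A = closed_range B.
Proof.
rewrite /closed_range => AB; move: (closure_range_submod A) (closure_range_submod B).
move: (@closed_closure _ (range A)) (@closed_closure _ (range B)).
by rewrite AB => c c' m m'; congr ClosedSubspace; exact: Prop_irrelevance.
Qed.

Section Intertwiner.
Variables (R : realType) (H : hilbertType R[i]) (n : nat) (T : 'I_n -> bop H H).
Local Notation C := R[i].
Variables (a : 'cV[C]_n) (u : 'M[C]_n).
Local Notation W := (row_op T).
Local Notation T' := (unitary_tuple u (ball_aut_tuple a T)).
Local Notation W' := (row_op T').
Hypotheses (cW : contractive W) (a1 : unit_ball a) (uu : u \is unitarymx).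

Lemma defect_unitary :
  exists2 tau : bop (subspace_type (closed_range (codefect W)))
                    (subspace_type (closed_range (codefect W'))),
    unitary_op tau & forall p x,
      val p = codefect W (ball_s a *: resolvent T a x) -> val (tau p) = codefect W' x.
Proof.
pose K : bop H H := ball_s a *: resolvent T a.
have s0 := ball_s_gt0 a1.
have AB x : `|(codefect W ∘ K) x| = `|codefect W' x|.
  apply: norm_eq_sqr; rewrite (codefect_norm (transform_contractive cW a1 uu)).
  rewrite transform_gram// bop_compE bopZE bop_mapZ normrZ exprMn codefect_norm//.
  by rewrite gtr0_norm.
have := range_unitary AB; rewrite (@closed_range_eq _ _ _ _ _ (codefect W)) //.
apply/seteqP; split=> _ [x _ <-]; first by exists (K x).
(* This is [K^-1 x], as [Ra] inverts [1 - A W^†]. *)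
exists ((ball_s a)^-1 *: (x - scalar_row H a (W^† x))) => //.
rewrite bop_compE bopZE [resolvent T a _]bop_mapZ scalerA mulfV ?gt_eqF// scale1r.
congr (codefect W _).
have [_ /(congr1 (fun B : bop H H => B x))] := resolventP cW a1.
by rewrite !bopE.
Qed.

(** After [char_op_kernel] both sides are an inner product minus a scalar multiple of a resolvent
    term. The inner products agree by unitarity of [tau]; the resolvent terms are matched through
    [codefE] and [transform_resolvent]. *)
Lemma transform_coincide_weakly :
  coincide_weakly (op_precomp (char_fun T) (fun z => ball_aut a (u^t* *m z)))
    (char_fun T').
Proof.
have cW' := transform_contractive cW a1 uu.
have uball z : unit_ball z -> unit_ball (u^t* *m z).
  by move=> z1; rewrite /unit_ball /= unitary_cdot.
have phi1 z : unit_ball z -> unit_ball (ball_aut a (u^t* *m z)).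
  by move=> /uball z1; exact: ball_aut_ball.
split.
- by exists 1 => z z1 x; rewrite mul1r; apply: char_fun_contractive => //; exact: phi1.
- by exists 1 => z z1 x; rewrite mul1r; exact: char_fun_contractive.
have [tau tauU tauE] := defect_unitary.
exists tau => // z w z1 w1; have [tt tt'] := tauU.
(* The adjoint form of [tau D K = D']: on the defect space, [D' = K^† D tau^†]. *)
have codefE p : codefect W' (val p) =
    ball_s a *: (resolvent T a)^† (codefect W (val (tau^† p))).
  apply: inner_extr => x.
  pose q : subspace_type (closed_range (codefect W)) :=
    Sub (codefect W (ball_s a *: resolvent T a x)) 
      (mem_set (@closed_range_val R _ _ (codefect W) _)).
  rewrite adjointPr codefect_selfadjoint// -(tauE q x erefl).
  rewrite -[LHS]/('[tau q, p]) adjointP -[LHS]/('[val q, val (tau^† p)]).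
  rewrite [val q]/= adjointP codefect_selfadjoint// innerZl innerZr -adjointP.
  by rewrite geC0_conj// ltW ?ball_s_gt0.
apply: bopP => p; apply: inner_extr => q.
set zeta := ball_aut a (u^t* *m z); set omega := ball_aut a (u^t* *m w).
rewrite -[LHS]/('[q, char_fun T' w ((char_fun T' z)^† p)]).
rewrite -[RHS]/('[q, tau (char_fun T omega ((char_fun T zeta)^† (tau^† p)))]).
rewrite [in LHS]adjointPr [in RHS]adjointPr [in RHS]adjointPr.
have tauI : '[val q, val p] = '[val (tau^† q), val (tau^† p)].
  have ttq : tau (tau^† q) = q := congr1 (fun B : bop _ _ => B q) tt'.
  rewrite -[RHS]/('[tau^† q, tau^† p]) -(adjointP tau (tau^† q) p) ttq.
  exact: erefl.
rewrite -[LHS]/('[val ((char_fun T' w)^† q), val ((char_fun T' z)^† p)]).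
rewrite -[RHS]/('[val ((char_fun T omega)^† (tau^† q)), val ((char_fun T zeta)^† (tau^† p))]).
rewrite (char_fun_adjoint_val cW') (char_fun_adjoint_val cW').
rewrite (char_fun_adjoint_val cW) (char_fun_adjoint_val cW).
rewrite (char_op_kernel cW' _ _ w1 z1) (char_op_kernel cW _ _ (phi1 _ w1) (phi1 _ z1)).
congr (_ - _); first exact: tauI.
rewrite (codefE q) (codefE p); move: (codefect W _) (codefect W _) => x y.
rewrite (bop_mapZ (resolvent T' w)^†) (bop_mapZ (resolvent T' z)^†).
rewrite (transform_resolvent cW a1 uu y w1) (transform_resolvent cW a1 uu x z1).
rewrite -/zeta -/omega !innerZl !innerZr.
move: '[(resolvent T omega)^† y, _] => X.
(* Only scalars remain: the two factors [s / (1 - cdot a _)] from the resolvents, one of them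
   conjugated, make up the ratio between the kernels. *)
rewrite /zeta /omega (ball_aut_cdot a1 (uball _ w1) (uball _ z1)).
have -> : cdot (u^t* *m z) (u^t* *m w) = cdot z w by exact: unitary_cdot.
rewrite (geC0_conj (ltW (ball_s_gt0 a1))) fmorphV rmorphB rmorph1 /= cdot_conj.
by rewrite invfM; ring.
Qed.

End Intertwiner.

Theorem theorem2p6 (R : realType) (n : nat) (H : hilbertType R[i])
    (T : 'I_n -> bop H H) (a : 'cV[R[i]]_n) (u : 'M[R[i]]_n) :
  commuting_contractive T -> unit_ball a -> u \is unitarymx ->
  coincide_weakly
    (op_precomp (char_fun T) (fun z => ball_aut a (u^t* *m z)))
    (char_fun (unitary_tuple u (ball_aut_tuple a T))).
Proof.
move=> [_ pT] a1 uu; apply: transform_coincide_weakly => //.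
rewrite -[X in contractive X]adjointK; apply/contractive_adjoint/contractive_positive.
by rewrite adjointK row_op_comp_adjoint.
Qed.
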